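(* There exists a sequence $\epsilon_k\to 0$ such that for every $k$ and every $r$ with $$(1+\epsilon_k)\,\frac{2^k}{k}\,\ln k \le r \le (1-\epsilon_k)\, 2^k\ln 2,$$ the space of satisfying assignments of a random $k$-CNF formula with $n$ variables and $rn$ clauses shatters.
   Context: A random $k$-CNF formula with $n$ variables $x_1,\dots,x_n$ and $m$ clauses is a set of $m$ distinct clauses chosen uniformly at random among all $2^k\binom{n}{k}$ possible $k$-clauses (disjunctions of $k$ literals over $k$ distinct variables). Truth assignments are elements of $\{0,1\}^n$; $\sigma,\tau$ are adjacent iff their Hamming distance is 1. For a formula $F$ let $H=H_F:\{0,1\}^n\to\mathbb{N}$ count the clauses of $F$ violated by an assignment, and let $\mathcal{S}(F)=\{\sigma:H(\sigma)=0\}$. The height of a path $\sigma_0,\dots,\sigma_t$ in $\{0,1\}^n$ is $\max_i H(\sigma_i)$. Clusters are the connected components of $\mathcal{S}(F)$; a region is a nonempty union of clusters. W.h.p. means with probability tending to 1 as $n\to\infty$. The space of solutions shatters if there exist constants $\beta,\gamma,\zeta,\theta>0$ such that w.h.p. $\mathcal{S}(F)$ can be partitioned into regions such that: (1) there are at least $e^{\beta n}$ regions; (2) each region contains at most an $e^{-\gamma n}$ fraction of all solutions; (3) the Hamming distance between any two distinct regions is at least $\zeta n$; (4) every path between assignments in distinct regions has height at least $\theta n$. *)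

(* Defs.v *)
From mathcomp Require Import all_boot all_order all_algebra.
From mathcomp Require Import all_classical all_reals all_analysis.
(* [classical_sets] shadows [set0], [cover], [partition], ...; everything here
   is finite, so the [finset] versions are brought back. *)
From mathcomp Require Import finset.

Set Implicit Arguments.
Unset Strict Implicit.
Unset Printing Implicit Defensive.

Import Order.TTheory GRing.Theory Num.Theory.
Import numFieldNormedType.Exports.

Local Open Scope ring_scope.

Notation assignment n := {ffun 'I_n -> bool}.

Definition hamming (n : nat) (s t : assignment n) : nat :=
  #|[set i | s i != t i]|.

Definition hamming_adjacent (n : nat) : rel (assignment n) :=
  [rel s t | hamming s t == 1%N].

(* [(i, true)] is the literal x_i and [(i, false)] its negation. *)
Notation literal n := ('I_n * bool)%type.

Notation clause n := {set literal n}.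

Definition kclauses (n k : nat) : {set clause n} :=
  [set c : clause n | (#|c| == k) && (#|[set l.1 | l in c]| == k)].

Notation formula n := {set clause n}.

Definition kcnf (n k m : nat) : {set formula n} :=
  [set F : formula n | (F \subset kclauses n k) && (#|F| == m)].

Definition violates (n : nat) (s : assignment n) (c : clause n) : bool :=
  [forall l in c, s l.1 != l.2].

Definition energy (n : nat) (F : formula n) (s : assignment n) : nat :=
  #|[set c in F | violates s c]|.

Definition solutions (n : nat) (F : formula n) : {set assignment n} :=
  [set s | energy F s == 0%N].

Definition height (n : nat) (F : formula n) (p : seq (assignment n)) : nat :=
  (\max_(s <- p) energy F s)%N.

Definition solution_adjacent (n : nat) (F : formula n) : rel (assignment n) :=
  [rel s t | [&& s \in solutions F, t \in solutions F & hamming_adjacent s t]].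

Definition clusters (n : nat) (F : formula n) : {set {set assignment n}} :=
  equivalence_partition (connect (solution_adjacent F)) (solutions F).

Definition is_region (n : nat) (F : formula n) (A : {set assignment n}) : Prop :=
  A != set0 /\
  exists C : {set {set assignment n}}, C \subset clusters F /\ A = cover C.

Definition shattered (R : realType) (beta gamma zeta theta : R)
    (n : nat) (F : formula n) : Prop :=
  exists P : {set {set assignment n}},
    [/\ partition P (solutions F) /\ (forall A, A \in P -> is_region F A),
        expR (beta * n%:R) <= #|P|%:R,
        forall A, A \in P ->
          #|A|%:R <= expR (- gamma * n%:R) * #|solutions F|%:R,
        forall A B, A \in P -> B \in P -> A != B ->
          forall s t, s \in A -> t \in B -> zeta * n%:R <= (hamming s t)%:R
      & forall A B, A \in P -> B \in P -> A != B ->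
          forall s p, s \in A -> last s p \in B -> path (@hamming_adjacent n) s p ->
            theta * n%:R <= (height F (s :: p))%:R].

Definition finset_uniform_prob (R : realType) (T : finType) (Omega : {set T})
    (E : T -> Prop) : R :=
  #|[set x in Omega | `[< E x >]]|%:R / #|Omega|%:R.

(* The number of clauses rn is rounded down. If there are fewer than m
   k-clauses, then [kcnf n k m] is empty and the ratio is 0; for fixed r and
   k >= 2 this concerns only finitely many n. *)
Definition whp_kcnf (R : realType) (k : nat) (r : R)
    (E : forall n : nat, formula n -> Prop) : Prop :=
  ((fun n : nat => finset_uniform_prob R (kcnf n k (Num.truncn (r * n%:R))) (@E n))
     @ \oo --> (1 : R))%classic.

Definition shatters (R : realType) (k : nat) (r : R) : Prop :=
  exists beta gamma zeta theta : R,
    [/\ 0 < beta, 0 < gamma, 0 < zeta & 0 < theta] /\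
    whp_kcnf k r (@shattered R beta gamma zeta theta).

(* Main.v *)
(** The uniform set of [m] clauses is compared with [m] independent clauses made
    of [k] independent literals: such a sequence is a formula with distinct
    clauses over distinct variables with probability bounded below, so events
    of vanishing probability stay so.

    In the independent model every solution [s] gets the weight [prod_c w(c, s)],
    where [w = 1 + g] vanishes on violated clauses and [g] has no Fourier mass on
    levels 0, 1, 2.  Pair correlations are then cubic in the overlap, so the
    second moment of the total weight is [(1 + o(1))] times the squared first
    moment and Chebyshev's inequality gives concentration directly, with no
    sharp-threshold theorem.  By Cauchy-Schwarz there are w.h.p. at least
    [2^n exp (- (1 + O(1/k)) 2^-k r n)] solutions.

    A first-moment bound shows that all but an exponentially small fraction of
    the solutions [s] are isolated: every assignment at distance between [a n]
    and [3 a n] from [s], with [a = c / k] and [c = (ln k)^(-1/2)], has linear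
    energy.  The solutions within [a n] of an isolated one form a region, two
    such balls are equal or far apart, and the remaining, non-isolated,
    solutions are collected in one further region. *)

Require Import Defs.
From mathcomp Require Import all_boot all_order all_algebra.
From mathcomp Require Import all_classical all_reals all_analysis.
From mathcomp Require Import finset ring lra zify.
Import Order.TTheory GRing.Theory Num.Theory.
Import numFieldNormedType.Exports.
Local Open Scope ring_scope.

Set Implicit Arguments.
Unset Strict Implicit.
Unset Printing Implicit Defensive.

(** * Averages over finite types *)

Section Average.
Variables (R : realType).

Definition avg (T : finType) (f : T -> R) : R := (\sum_x f x) / #|T|%:R.

Lemma eq_avg (T : finType) (f g : T -> R) : f =1 g -> avg f = avg g.
Proof. by move=> fg; rewrite /avg (eq_bigr _ (fun x _ => fg x)). Qed.

Lemma avg_cst (T : finType) (a : R) : (0 < #|T|)%N -> avg (fun _ : T => a) = a.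
Proof.
move=> T0; rewrite /avg sumr_const -[a *+ _]mulr_natr mulfK //.
by rewrite pnatr_eq0 -lt0n.
Qed.

Lemma avgD (T : finType) (f g : T -> R) :
  avg (fun x => f x + g x) = avg f + avg g.
Proof. by rewrite /avg big_split mulrDl. Qed.

Lemma avgZ (T : finType) (a : R) (f : T -> R) :
  avg (fun x => a * f x) = a * avg f.
Proof. by rewrite /avg -mulr_sumr mulrA. Qed.

Lemma avgB (T : finType) (f g : T -> R) :
  avg (fun x => f x - g x) = avg f - avg g.
Proof. by rewrite /avg sumrB mulrBl. Qed.

Lemma avg_sum (T I : finType) (P : pred I) (f : I -> T -> R) :
  avg (fun x => \sum_(i | P i) f i x) = \sum_(i | P i) avg (f i).
Proof. by rewrite /avg exchange_big /= mulr_suml. Qed.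

Lemma le_avg (T : finType) (f g : T -> R) :
  (forall x, f x <= g x) -> avg f <= avg g.
Proof.
by move=> fg; rewrite /avg ler_wpM2r ?invr_ge0 // ler_sum.
Qed.

(** Independence of the coordinates of a uniform function, as distributivity of products over
    sums. *)
Lemma avg_prod (T : finType) (m : nat) (F : 'I_m -> T -> R) :
  avg (fun w : {ffun 'I_m -> T} => \prod_j F j (w j)) = \prod_j avg (F j).
Proof.
rewrite /avg -bigA_distr_bigA /= big_split /= card_ffun card_ord.
by rewrite prodr_const card_ord natrX exprVn.
Qed.

Definition prob (T : finType) (A : pred T) : R := avg (fun x => (A x)%:R).

Lemma le_prob (T : finType) (A B : pred T) :
  (forall x, A x -> B x) -> prob A <= prob B.
Proof.
by move=> AB; apply: le_avg => x; rewrite ler_nat; case: (A x) (AB x) => // ->.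
Qed.

Lemma prob_card (T : finType) (A : pred T) : prob A = #|A|%:R / #|T|%:R.
Proof. by rewrite /prob /avg -natr_sum -sum1_card [in RHS]big_mkcond. Qed.

Lemma probU (T : finType) (A B : pred T) :
  prob (fun x => A x || B x) <= prob A + prob B.
Proof.
rewrite /prob -avgD; apply: le_avg => x.
by rewrite -natrD ler_nat; case: (A x); case: (B x).
Qed.

Lemma markov_avg (T : finType) (f : T -> R) (a : R) : 0 < a ->
  (forall x, 0 <= f x) -> prob (fun x => a <= f x) <= avg f / a.
Proof.
move=> a0 f0; rewrite mulrC -avgZ; apply: le_avg => x.
have [afx|_] := leP a (f x); first by rewrite mulrC ler_pdivlMr // mul1r.
by rewrite mulr_ge0 // invr_ge0 ltW.
Qed.

(** The factor 4 is the inverse square of the relative deviation 1/2; it multiplies the relative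
    variance. *)
Lemma chebyshev_avg (T : finType) (f : T -> R) (a : R) : (0 < #|T|)%N ->
  0 < a -> avg f = a ->
  prob (fun x => f x <= a / 2) <= 4 * (avg (fun x => f x ^+ 2) / a ^+ 2 - 1).
Proof.
move=> T0 a0 fa.
have v : avg (fun x => (f x - a) ^+ 2) = avg (fun x => f x ^+ 2) - a ^+ 2.
  transitivity (avg (fun x => f x ^+ 2 - ((2 * a) * f x - a ^+ 2))).
    by apply: eq_avg => x; ring.
  by rewrite !avgB avgZ fa avg_cst //; ring.
have a2 : 0 < a ^+ 2 / 4 by rewrite divr_gt0 // exprn_gt0.
have := @markov_avg _ (fun x => (f x - a) ^+ 2) _ a2 (fun x => sqr_ge0 _).
rewrite v => h; apply: le_trans (le_trans h _); last first.
  rewrite le_eqVlt; apply/orP; left; apply/eqP; field.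
  by rewrite gt_eqF.
apply: le_prob => x fx.
have h1 : a / 2 <= a - f x by lra.
rewrite -[(f x - a) ^+ 2]sqrrN opprB; apply: le_trans (_ : (a / 2) ^+ 2 <= _).
  by rewrite expr_div_n; lra.
by rewrite ler_pXn2r // ?nnegrE; lra.
Qed.

End Average.

(** Cauchy-Schwarz against the constant 1, from the nonnegative double sum of [(f x - f y) ^+ 2]. *)
Lemma sum_sqr_le (R : realType) (T : finType) (S : {set T}) (f : T -> R) :
  (\sum_(x in S) f x) ^+ 2 <= #|S|%:R * \sum_(x in S) f x ^+ 2.
Proof.
have h : 0 <= \sum_(x in S) \sum_(y in S) (f x - f y) ^+ 2.
  by apply: sumr_ge0 => x _; apply: sumr_ge0 => y _; apply: sqr_ge0.
have e : \sum_(x in S) \sum_(y in S) (f x - f y) ^+ 2 =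
   2 * (#|S|%:R * \sum_(x in S) f x ^+ 2 - (\sum_(x in S) f x) ^+ 2).
  transitivity (\sum_(x in S) (#|S|%:R * f x ^+ 2 +
     \sum_(y in S) f y ^+ 2 - 2 * f x * \sum_(y in S) f y)).
    apply: eq_bigr => x _.
    rewrite mulr_sumr mulr_natl -sumr_const -big_split /= -sumrB.
    by apply: eq_bigr => y _; ring.
  rewrite sumrB big_split /= -mulr_sumr sumr_const -mulr_suml -mulr_sumr.
  by rewrite -mulr_natl; ring.
by rewrite e in h; lra.
Qed.

(** * Random literals and clauses *)

Section RandomClause.
Variables (R : realType) (n : nat).
Hypothesis n_gt0 : (0 < n)%N.

Definition spin (s : assignment n) (l : literal n) : R :=
  if s l.1 == l.2 then 1 else -1.

Definition unsat (s : assignment n) (l : literal n) : R := (s l.1 != l.2)%:R.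

(** The normalised inner product of the two assignments read as sign vectors; [avg_spin2] identifies
    it with the spin correlation on a random literal. *)
Definition overlap (s t : assignment n) : R := 1 - 2 * (hamming s t)%:R / n%:R.

Lemma unsatE s l : unsat s l = (1 - spin s l) / 2.
Proof. by rewrite /unsat /spin; case: eqP => _ /=; lra. Qed.

Lemma card_literal : #|{: literal n}| = (2 * n)%N.
Proof. by rewrite card_prod card_ord card_bool mulnC. Qed.

Lemma card_literal_gt0 : (0 < #|{: literal n}|)%N.
Proof. by rewrite card_literal muln_gt0. Qed.

Lemma sum_literal (f : literal n -> R) :
  \sum_l f l = \sum_(i < n) (f (i, true) + f (i, false)).
Proof.
under [RHS]eq_bigr do rewrite -(big_bool _ (fun b => f (_, b))).
by rewrite pair_bigA; apply: eq_bigr => -[].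
Qed.

Lemma avg_spin s : avg (spin s) = 0.
Proof.
rewrite /avg sum_literal big1 ?mul0r // => i _.
by rewrite /spin /=; case: (s i) => /=; lra.
Qed.

Lemma avg_spin2 s t : avg (fun l => spin s l * spin t l) = overlap s t.
Proof.
rewrite /avg sum_literal card_literal /overlap /hamming.
transitivity ((\sum_(i < n) (2 - 4 * (s i != t i)%:R)) / (2 * n)%:R : R).
  congr (_ / _); apply: eq_bigr => i _.
  by rewrite /spin /=; case: (s i); case: (t i) => /=; lra.
rewrite sumrB sumr_const card_ord -mulr_sumr -natr_sum natrM.
rewrite -[#|[set _ | _]|]sum1_card.
rewrite (_ : (\sum_(i in [set i | s i != t i]) 1 = \sum_i (s i != t i))%N).
  have n0 : n%:R != 0 :> R by rewrite pnatr_eq0 -lt0n.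
  by rewrite -[2 *+ _]mulr_natr; field.
by rewrite [LHS]big_mkcond; apply: eq_bigr => i _; rewrite inE; case: eqP.
Qed.

Lemma avg_unsat s : avg (unsat s) = 1 / 2.
Proof.
transitivity (avg (fun l => 2^-1 * (1 - spin s l))).
  by apply: eq_avg => l; rewrite unsatE mulrC.
by rewrite avgZ avgB avg_cst ?avg_spin ?card_literal_gt0//; lra.
Qed.

Lemma avg_spin_unsat s t :
  avg (fun l => spin s l * unsat t l) = - overlap s t / 2.
Proof.
transitivity (avg (fun l => 2^-1 * (spin s l - spin s l * spin t l))).
  by apply: eq_avg => l; rewrite unsatE; lra.
by rewrite avgZ avgB avg_spin avg_spin2; lra.
Qed.

Lemma avg_unsat_spin s t :
  avg (fun l => unsat s l * spin t l) = - overlap s t / 2.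
Proof.
transitivity (avg (fun l => 2^-1 * (spin t l - spin s l * spin t l))).
  by apply: eq_avg => l; rewrite unsatE; lra.
by rewrite avgZ avgB avg_spin avg_spin2; lra.
Qed.

Lemma avg_unsat2 s t :
  avg (fun l => unsat s l * unsat t l) = (1 + overlap s t) / 4.
Proof.
transitivity (avg (fun l => 4^-1 * (1 - spin t l - (spin s l - spin s l * spin t l)))).
  by apply: eq_avg => l; rewrite !unsatE; lra.
by rewrite avgZ !avgB !avg_spin avg_spin2 avg_cst ?card_literal_gt0//; lra.
Qed.

End RandomClause.

(** * Clause weights without low Fourier levels *)

Lemma card_ord_count k (P : pred nat) :
  #|[pred i : 'I_k | P i]| = (\sum_(0 <= i < k) P i)%N.
Proof. by rewrite big_mkord -sum1_card big_mkcond. Qed.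

(** Positions are grouped in consecutive triples [3 t], [3 t + 1], [3 t + 2]; the at most two
    positions left over lie in no triple with [t < k %/ 3]. *)
Lemma card_triple k t : (t < k %/ 3)%N ->
  #|[pred i : 'I_k | (i %/ 3 == t)%N]| = 3%N.
Proof.
move=> tM; rewrite (card_ord_count _ (fun i => (i %/ 3 == t)%N)).
have h1 : (3 * t <= k)%N by lia.
have h2 : (3 * t + 3 <= k)%N by lia.
rewrite (big_cat_nat (leq0n (3 * t)) h1) (big_cat_nat (leq_addr 3 (3 * t)) h2) /=.
have z0 : (\sum_(0 <= i < 3 * t) (i %/ 3 == t) = 0)%N.
  by rewrite big_nat_cond big1 // => i /andP[/andP[_ h] _]; case: eqP => //; lia.
have z1 : (\sum_(3 * t + 3 <= i < k) (i %/ 3 == t) = 0)%N.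
  by rewrite big_nat_cond big1 // => i /andP[/andP[h _] _]; case: eqP => //; lia.
have z2 : (\sum_(3 * t <= i < 3 * t + 3) (i %/ 3 == t) = \sum_(3 * t <= i < 3 * t + 3) 1)%N.
  apply: eq_big_nat => i /andP[h h'].
  by case: eqP => //; lia.
by rewrite z0 z1 z2 sum_nat_const_nat addKn.
Qed.

Lemma prodr_if (R : realType) (k : nat) (P : pred 'I_k) (a b : R) :
  \prod_(i < k) (if P i then a else b) = a ^+ #|P| * b ^+ (k - #|P|).
Proof.
rewrite (bigID P) /=; congr (_ * _).
  by rewrite -prodr_const; apply: eq_bigr => i ->.
rewrite (_ : (k - #|P|)%N = #|predC P|); last first.
  by rewrite -[X in (X - _)%N]card_ord -(cardC P) addKn.
by rewrite -prodr_const; apply: eq_bigr => i /negPf ->.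
Qed.

Section Weight.
Variables (R : realType) (n k : nat).
Hypothesis n_gt0 : (0 < n)%N.
Hypothesis k_ge6 : (6 <= k)%N.

(** Literals are ordered and may repeat or contradict each other, so positions are independent and
    expectations factor. *)
Definition lclause := {ffun 'I_k -> literal n}.

Definition lviolates (s : assignment n) (c : lclause) : bool :=
  [forall i, s (c i).1 != (c i).2].

Lemma lviolatesE s (c : lclause) : (lviolates s c)%:R = \prod_i unsat R s (c i).
Proof.
rewrite /lviolates; case: forallP => [h|h].
  by rewrite big1 // => i _; rewrite /unsat h.
case: (pickP (fun i => s (c i).1 == (c i).2)) => [i hi|h'].
  by rewrite (bigD1 i) //= /unsat hi mul0r.
by case: h => i; rewrite h'.
Qed.

(* Each factor [spin] raises the lowest Fourier level by one; a whole triple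
   kills levels 0, 1 and 2, so that correlations are cubic in the overlap. *)
Definition gadget (t : nat) (s : assignment n) (c : lclause) : R :=
  \prod_(i < k) (if (i %/ 3 == t)%N then spin R s (c i) else unsat R s (c i)).

(** A single gadget would have self-correlation 8. Averaging over the disjoint triples divides this
    excess by [k %/ 3], so that the self-correlation tends to 1 as [k] grows. *)
Definition weight (s : assignment n) (c : lclause) : R :=
  1 + (\sum_(t < k %/ 3) gadget t s c) / (k %/ 3)%:R.

(** The covariance of the two weights at overlap [u], up to the factor [2 ^- k]: the first term
    comes from equal triples, the second from distinct ones. *)
Definition correlation (u : R) : R :=
  8 / (k %/ 3)%:R * (u ^+ 3 * ((1 + u) / 2) ^+ (k - 3)) +
  (1 - (k %/ 3)%:R^-1) * (u ^+ 6 * ((1 + u) / 2) ^+ (k - 6)).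

Lemma triples_gt0 : (0 < k %/ 3)%N. Proof. by rewrite divn_gt0 //; lia. Qed.

Lemma triples_neq0 : (k %/ 3)%:R != 0 :> R.
Proof. by rewrite pnatr_eq0 -lt0n triples_gt0. Qed.

(** Each violated literal has spin -1 and [unsat] equal to 1, and a triple contains an odd number of
    spins. *)
Lemma gadget_violated t s c : (t < k %/ 3)%N -> lviolates s c ->
  gadget t s c = -1.
Proof.
move=> tM /forallP vc.
transitivity (\prod_(i < k) (if (i %/ 3 == t)%N then -1 else 1) : R).
  by apply: eq_bigr => i _; rewrite /spin /unsat vc (negPf (vc i)).
rewrite (prodr_if (fun i : 'I_k => (i %/ 3 == t)%N)) card_triple // expr1n.
by rewrite mulr1; ring.
Qed.

Lemma weight_violated s c : lviolates s c -> weight s c = 0.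
Proof.
move=> vc; rewrite /weight (eq_bigr (fun=> -1)).
  by rewrite sumrN sumr_const card_ord mulNr mulfV ?triples_neq0 // subrr.
by move=> t _; rewrite gadget_violated.
Qed.

Lemma avg_gadget t s : (t < k %/ 3)%N -> avg (gadget t s) = 0.
Proof.
move=> tM; rewrite /gadget.
rewrite (@avg_prod _ _ _ (fun (i : 'I_k) l => if (i %/ 3 == t)%N then spin R s l else unsat R s l)).
(* Position [3 * t] carries a spin, of mean zero, which annihilates the whole product. *)
have tk : (3 * t < k)%N by lia.
rewrite (bigD1 (Ordinal tk)) //= mulKn // eqxx.
by rewrite avg_spin ?mul0r.
Qed.

(** A position contributes [u] if both gadgets put a spin there, [- u / 2] if exactly one does, and
    [(1 + u) / 4] if none does. Distinct triples cover six positions, so the signs cancel. *)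
Lemma avg_gadget2 t t' s s' : (t < k %/ 3)%N -> (t' < k %/ 3)%N ->
  let u := overlap R s s' in
  avg (fun c => gadget t s c * gadget t' s' c) =
  2 ^- k * (if t == t' then 8 * (u ^+ 3 * ((1 + u) / 2) ^+ (k - 3))
            else u ^+ 6 * ((1 + u) / 2) ^+ (k - 6)).
Proof.
move=> tM tM' u.
pose P t := fun i : 'I_k => (i %/ 3 == t)%N.
transitivity (avg (fun c : lclause => \prod_(i < k)
   ((if P t i then spin R s (c i) else unsat R s (c i)) *
    (if P t' i then spin R s' (c i) else unsat R s' (c i))))).
  by apply: eq_avg => c; rewrite big_split.
rewrite (@avg_prod _ _ _ (fun (i : 'I_k) l =>
   (if P t i then spin R s l else unsat R s l) *
    (if P t' i then spin R s' l else unsat R s' l))).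
have e : (1 + u) / 4 = 2^-1 * ((1 + u) / 2) by field.
case: eqP => [<-|/eqP tt'].
  rewrite (eq_bigr (fun i => if P t i then u else (1 + u) / 4)); last first.
    by move=> i _; case: ifP => _; rewrite ?avg_spin2 ?avg_unsat2.
  rewrite prodr_if card_triple // e exprMn.
  have -> : 2 ^- k = 2 ^- 3 * 2 ^- (k - 3) :> R.
    by rewrite -invfM -exprD subnKC //; lia.
  rewrite exprVn; set x := ((1 + u) / 2) ^+ _.
  by field; rewrite expf_neq0 // pnatr_eq0.
rewrite (eq_bigr (fun i => if P t i || P t' i then - u / 2 else (1 + u) / 4)); last first.
  move=> i _; rewrite /P; case: (i %/ 3 =P t)%N => [->|_] /=.
    by rewrite (negPf tt') avg_spin_unsat.
  by case: ifP => _; rewrite ?avg_unsat_spin ?avg_unsat2.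
have c6 : #|[pred i | P t i || P t' i]| = 6%N.
  have := cardUI [pred i | P t i] [pred i | P t' i].
  rewrite !card_triple // [X in (_ + X)%N](_ : _ = 0%N) ?addn0.
    by move=> e6; apply: etrans e6; apply: eq_card.
  apply: eq_card0 => i; rewrite !inE /P.
  by apply/negP => /andP[/eqP -> /eqP]; apply/eqP.
rewrite (prodr_if (fun i => P t i || P t' i)) c6 e [(2^-1 * _) ^+ _]exprMn.
have -> : 2 ^- k = 2 ^- 6 * 2 ^- (k - 6) :> R.
  by rewrite -invfM -exprD subnKC.
rewrite exprVn; set x := ((1 + u) / 2) ^+ _.
by field; rewrite expf_neq0 // pnatr_eq0.
Qed.

Lemma card_lclause_gt0 : (0 < #|{: lclause}|)%N.
Proof. by rewrite card_ffun expn_gt0 card_literal_gt0. Qed.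

Lemma avg_weight s : avg (weight s) = 1.
Proof.
rewrite /weight avgD avg_cst ?card_lclause_gt0 //.
rewrite (@eq_avg _ _ _ (fun c => (k %/ 3)%:R^-1 * \sum_(t < k %/ 3) gadget t s c)).
  by rewrite avgZ avg_sum big1 ?mulr0 ?addr0 // => t _; rewrite avg_gadget.
by move=> c; rewrite mulrC.
Qed.

Lemma avg_weight2 s s' :
  avg (fun c => weight s c * weight s' c) =
  1 + 2 ^- k * correlation (overlap R s s').
Proof.
set u := overlap R s s'; set M : R := (k %/ 3)%:R.
have M0 : M != 0 by apply: triples_neq0.
transitivity (avg (fun c => 1 + (M^-1 * \sum_(t < k %/ 3) gadget t s c) +
  ((M^-1 * \sum_(t < k %/ 3) gadget t s' c) + M^-1 ^+ 2 *
    \sum_(t < k %/ 3) \sum_(t' < k %/ 3) gadget t s c * gadget t' s' c))).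
  apply: eq_avg => c; rewrite /weight -/M.
  by rewrite -big_distrlr /=; field.
rewrite !avgD !avgZ !avg_sum avg_cst ?card_lclause_gt0 //.
have z s0 : \sum_(t < k %/ 3) avg (gadget t s0) = 0.
  by rewrite big1 // => t _; rewrite avg_gadget.
rewrite !z !mulr0 addr0 add0r; congr (_ + _).
set A := 8 * (u ^+ 3 * ((1 + u) / 2) ^+ (k - 3)).
set B := u ^+ 6 * ((1 + u) / 2) ^+ (k - 6).
(* For each [t] there is one diagonal term and [M - 1] equal off-diagonal ones. *)
rewrite (eq_bigr (fun t => 2 ^- k * (A + (M - 1) * B))); last first.
  move=> t _; rewrite avg_sum (bigD1 t) //= avg_gadget2 // eqxx -/u -/A.
  rewrite (eq_bigr (fun=> 2 ^- k * B)) => [|t' tt']; last first.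
    by rewrite eq_sym -val_eqE /= in tt'; rewrite avg_gadget2 // (negPf tt').
  rewrite sumr_const (_ : #|_| = (k %/ 3).-1).
    have Mp : (k %/ 3).-1%:R = M - 1 by rewrite -subn1 natrB ?triples_gt0.
    by rewrite -[(2 ^- k * B) *+ _]mulr_natl Mp; ring.
  by rewrite cardC1 card_ord.
rewrite sumr_const card_ord -[(2 ^- k * _) *+ _]mulr_natl -/M.
by rewrite /correlation -/u -/M /A /B; field; rewrite M0 expf_neq0 // pnatr_eq0.
Qed.

End Weight.

(** * Random formulas *)

Section RandomFormula.
Variables (R : realType) (n k m : nat).
Hypothesis n_gt0 : (0 < n)%N.
Hypothesis k_ge6 : (6 <= k)%N.

Definition lformula := {ffun 'I_m -> lclause n k}.

Definition lsolutions (w : lformula) : {set assignment n} :=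
  [set s | [forall j, ~~ lviolates s (w j)]].

Definition lenergy (w : lformula) (s : assignment n) : nat :=
  #|[set j | lviolates s (w j)]|.

Definition fweight (s : assignment n) (w : lformula) : R :=
  \prod_j weight R s (w j).

Lemma overlap_refl (s : assignment n) : overlap R s s = 1.
Proof.
rewrite /overlap /hamming (_ : [set i | _] = set0) ?cards0 ?mulr0 ?mul0r ?subr0 //.
by apply/setP => i; rewrite !inE eqxx.
Qed.

Lemma fweight_unsat s w : s \notin lsolutions w -> fweight s w = 0.
Proof.
rewrite inE negb_forall => /existsP[j]; rewrite negbK => vj.
by rewrite /fweight (bigD1 j) //= weight_violated ?mul0r.
Qed.

Lemma card_assignment : #|{: assignment n}| = (2 ^ n)%N.
Proof. by rewrite card_ffun card_bool card_ord. Qed.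

Lemma card_lformula_gt0 : (0 < #|{: lformula}|)%N.
Proof. by rewrite card_ffun expn_gt0 card_lclause_gt0. Qed.

Lemma avg_fweight s : avg (fweight s) = 1.
Proof.
rewrite /fweight (avg_prod (fun _ c => weight R s c)).
by rewrite big1 // => j _; rewrite avg_weight.
Qed.

Lemma avg_fweight2 s t :
  avg (fun w => fweight s w * fweight t w) =
  (1 + 2 ^- k * correlation k (overlap R s t)) ^+ m.
Proof.
transitivity (avg (fun w : lformula => \prod_j (weight R s (w j) * weight R t (w j)))).
  by apply: eq_avg => w; rewrite big_split.
rewrite (avg_prod (fun _ c => weight R s c * weight R t c)).
rewrite (eq_bigr (fun=> 1 + 2 ^- k * correlation k (overlap R s t))).
  by rewrite prodr_const card_ord.
by move=> j _; rewrite avg_weight2.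
Qed.

Definition partition_function (w : lformula) : R := \sum_s fweight s w.

Lemma avg_partition_function : avg partition_function = 2 ^+ n.
Proof.
rewrite /partition_function avg_sum (eq_bigr (fun=> 1)).
  by rewrite sumr_const card_assignment natrX.
by move=> s _; rewrite avg_fweight.
Qed.

Lemma avg_partition_function_sqr :
  avg (fun w => partition_function w ^+ 2) =
  \sum_(s : assignment n) \sum_(t : assignment n) (1 + 2 ^- k * correlation k (overlap R s t)) ^+ m.
Proof.
transitivity (avg (fun w => \sum_s \sum_t fweight s w * fweight t w)).
  by apply: eq_avg => w; rewrite /partition_function expr2 big_distrlr.
rewrite avg_sum; apply: eq_bigr => s _; rewrite avg_sum.
by apply: eq_bigr => t _; rewrite avg_fweight2.
Qed.

(** Controls the denominator of the Cauchy-Schwarz bound on the number of solutions; only overlap 1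
    enters. *)
Lemma avg_sum_fweight_sqr :
  avg (fun w => \sum_s fweight s w ^+ 2) =
  2 ^+ n * (1 + 2 ^- k * correlation k (1 : R)) ^+ m.
Proof.
rewrite avg_sum (eq_bigr (fun=> (1 + 2 ^- k * correlation k 1) ^+ m)).
  by rewrite sumr_const card_assignment -[LHS]mulr_natl natrX.
by move=> s _; have := avg_fweight2 s s; rewrite overlap_refl => <-.
Qed.

(** Cauchy-Schwarz on the solutions, outside which the weight vanishes. It turns concentration of
    the partition function into a lower bound on the number of solutions. *)
Lemma partition_function_le w :
  partition_function w ^+ 2 <= #|lsolutions w|%:R * \sum_s fweight s w ^+ 2.
Proof.
have -> : partition_function w = \sum_(s in lsolutions w) fweight s w.
  rewrite [RHS]big_mkcond; apply: eq_bigr => s _.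
  by case: ifPn => // /fweight_unsat ->.
apply: le_trans (sum_sqr_le _ _) _; rewrite ler_wpM2l //.
rewrite big_mkcond; apply: ler_sum => s _.
by case: ifP => // _; rewrite sqr_ge0.
Qed.

Lemma avg_lviolates s : avg (fun c : lclause n k => (lviolates s c)%:R : R) = 2 ^- k.
Proof.
transitivity (avg (fun c : lclause n k => \prod_i unsat R s (c i))).
  by apply: eq_avg => c; rewrite lviolatesE.
rewrite (avg_prod (fun _ l => unsat R s l)) (eq_bigr (fun=> 2^-1)).
  by rewrite prodr_const card_ord exprVn.
by move=> i _; rewrite avg_unsat // mul1r.
Qed.

Lemma avg_lviolates2 s t :
  avg (fun c : lclause n k => (lviolates s c)%:R * (lviolates t c)%:R : R) =
  2 ^- k * ((1 + overlap R s t) / 2) ^+ k.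
Proof.
transitivity (avg (fun c : lclause n k => \prod_i (unsat R s (c i) * unsat R t (c i)))).
  by apply: eq_avg => c; rewrite !lviolatesE big_split.
rewrite (avg_prod (fun _ l => unsat R s l * unsat R t l)).
rewrite (eq_bigr (fun=> 2^-1 * ((1 + overlap R s t) / 2))).
  by rewrite prodr_const card_ord exprMn exprVn.
by move=> i _; rewrite avg_unsat2 //; field.
Qed.

(** A generating function for the energy at [t] when [s] is a solution; it factors over clauses,
    each giving [(1 - V_s) (1 - (1 - q) V_t)] with [V] the violation indicators. *)
Lemma avg_solution_energy s t (q : R) :
  avg (fun w => (s \in lsolutions w)%:R * q ^+ lenergy w t) =
  (1 - 2 ^- k - (1 - q) * (2 ^- k * (1 - ((1 + overlap R s t) / 2) ^+ k))) ^+ m.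
Proof.
pose f (c : lclause n k) : R :=
  (1 - (lviolates s c)%:R) * (1 - (1 - q) * (lviolates t c)%:R).
transitivity (avg (fun w : lformula => \prod_j f (w j))).
  apply: eq_avg => w; rewrite /f big_split /=; congr (_ * _).
    rewrite inE; case: forallP => [h|h].
      by rewrite big1 // => j _; rewrite (negPf (h j)) subr0.
    case: (pickP (fun j => lviolates s (w j))) => [j vj|h'].
      by rewrite (bigD1 j) //= vj subrr mul0r.
    by case: h => j; rewrite h'.
  rewrite (eq_bigr (fun j => if lviolates t (w j) then q else 1)).
    rewrite (prodr_if (fun j => lviolates t (w j))) expr1n mulr1 /lenergy.
    by congr (_ ^+ _); apply: eq_card => j; rewrite inE.
  by move=> j _; case: (lviolates t (w j)) => /=; ring.
rewrite (avg_prod (fun _ c => f c)) (eq_bigr (fun=> avg f)) //.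
rewrite prodr_const card_ord; congr (_ ^+ _).
transitivity (avg (fun c : lclause n k => 1 - (lviolates s c)%:R -
   (1 - q) * ((lviolates t c)%:R - (lviolates s c)%:R * (lviolates t c)%:R))).
  by apply: eq_avg => c; rewrite /f; ring.
rewrite !(avgB, avgZ) !avg_lviolates avg_lviolates2 avg_cst ?card_lclause_gt0 //.
by ring.
Qed.

End RandomFormula.

(** The sum over assignments factors over coordinates. This is the source of all the ball and shell
    estimates below. *)
Lemma sum_expr_hamming (R : realType) n (s : assignment n) (y : R) :
  \sum_t y ^+ hamming s t = (1 + y) ^+ n.
Proof.
transitivity (\sum_(t : assignment n) \prod_i (if s i != t i then y else 1)).
  apply: eq_bigr => t _; rewrite (prodr_if (fun i => s i != t i)) expr1n mulr1.
  by rewrite /hamming; congr (_ ^+ _); apply: eq_card => i; rewrite inE.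
rewrite -(bigA_distr_bigA (fun i b => if s i != b then y else 1)) /=.
rewrite (eq_bigr (fun=> 1 + y)) ?prodr_const ?card_ord // => i _.
by rewrite big_bool; case: (s i) => //=; rewrite addrC.
Qed.

(** * Shattering from isolated solutions *)

Section Hamming.
Variable n : nat.
Implicit Types s t u : assignment n.

Lemma hammingC s t : hamming s t = hamming t s.
Proof. by apply: eq_card => i; rewrite !inE eq_sym. Qed.

Lemma hamming0 s : hamming s s = 0%N.
Proof. by apply: eq_card0 => i; rewrite !inE eqxx. Qed.

Lemma hamming_triangle u s t : (hamming s t <= hamming s u + hamming u t)%N.
Proof.
apply: leq_trans (_ : #|[set i | s i != u i] :|: [set i | u i != t i]| <= _)%N.
  apply: subset_leq_card; apply/fintype.subsetP => i; rewrite !inE.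
  by case: (s i =P u i) => [->|].
by rewrite cardsU leq_subr.
Qed.

End Hamming.

Section Shattering.
Variables (R : realType) (n : nat) (F : formula n) (A T : R).
Hypothesis A_ge1 : 1 <= A.
Hypothesis T_gt0 : 0 < T.
Implicit Types s t : assignment n.

(** The annulus is an energy barrier; its outer radius is three times the inner one, so points on
    opposite sides of it are more than [2 * A] apart. *)
Definition isolated (s : assignment n) : bool :=
  [forall t, (A <= (hamming s t)%:R <= 3 * A) ==> (T <= (energy F t)%:R)].

(** Regions are the fibres of this map on solutions, hence a partition with no transitivity to
    check. The fibre over the empty set is the leftover region. *)
Definition anchors (t : assignment n) : {set assignment n} :=
  [set s in solutions F | isolated s && ((hamming s t)%:R < A)].

Lemma isolatedP s t : isolated s -> A <= (hamming s t)%:R ->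
  (hamming s t)%:R <= 3 * A -> T <= (energy F t)%:R.
Proof. by move=> /forallP /(_ t) /implyP h h1 h2; apply: h; rewrite h1 h2. Qed.

Lemma isolated_far s t : isolated s -> t \in solutions F ->
  A <= (hamming s t)%:R -> 3 * A < (hamming s t)%:R.
Proof.
move=> is_s; rewrite inE => /eqP et h; rewrite ltNge; apply/negP => h'.
by have := isolatedP is_s h h'; rewrite et leNgt T_gt0.
Qed.

(** Any [x] in the symmetric difference of the two sets works: it is within [A] of one solution, and
    the other, having energy 0, cannot lie in the annulus around [x]. *)
Lemma anchors_sep s t : s \in solutions F -> t \in solutions F ->
  anchors s != anchors t ->
  exists2 x, isolated x &
    ((hamming x s)%:R < A /\ 3 * A < (hamming x t)%:R) \/
    ((hamming x t)%:R < A /\ 3 * A < (hamming x s)%:R).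
Proof.
move=> sS tS /eqP st.
case: (pickP (fun x => (x \in anchors s) (+) (x \in anchors t))) => [x|h]; last first.
  case: st; apply/setP => x; have := h x.
  by case: (x \in anchors s); case: (x \in anchors t).
rewrite !inE; case: (energy F x == 0%N) => //=; case ix: (isolated x) => //=.
have [xs|xs] := ltP (hamming x s)%:R A; have [xt|xt] := ltP (hamming x t)%:R A => // _.
  by exists x => //; left; split=> //; apply: isolated_far.
by exists x => //; right; split=> //; apply: isolated_far.
Qed.

Lemma anchors_hamming s t : s \in solutions F -> t \in solutions F ->
  anchors s != anchors t -> 2 * A < (hamming s t)%:R.
Proof.
move=> sS tS /(anchors_sep sS tS) [x _ h].
have := hamming_triangle s x t; have := hamming_triangle t x s.
rewrite (hammingC t s) -!(ler_nat R) !natrD.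
by case: h => -[]; lra.
Qed.

(** One step changes the distance to [x] by at most 1, and [A + 1 <= 3 * A], so the annulus cannot
    be jumped over. *)
Lemma path_crossing (x s : assignment n) p :
  path (@hamming_adjacent n) s p ->
  ((hamming x s)%:R < A) != ((hamming x (last s p))%:R < A) ->
  exists2 y, y \in s :: p & A <= (hamming x y)%:R <= 3 * A.
Proof.
elim: p s => [|y p IH] s /=; first by rewrite eqxx.
move=> /andP[/eqP sy py] h.
have h1 := hamming_triangle y x s; have h2 := hamming_triangle s x y.
move: h1 h2; rewrite (hammingC y s) sy -!(ler_nat R) !natrD mulr1n => h1 h2.
have [xy|xy] := boolP (((hamming x y)%:R < A) == ((hamming x s)%:R < A)).
  rewrite -(eqP xy) in h; have [z zp Hz] := IH _ py h.
  by exists z => //; rewrite inE zp orbT.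
have [xs|xs] := ltP (hamming x s)%:R A.
  rewrite xs in xy; have xy' : A <= (hamming x y)%:R by rewrite leNgt; case: ltP xy.
  exists y; [by rewrite !inE eqxx orbT|rewrite xy' /=].
  by apply: (le_trans h2); apply: (le_trans (lerD (ltW xs) (lexx 1))); have := A_ge1; lra.
have xy' : (hamming x y)%:R < A by move: xy; rewrite [X in _ != X]ltNge xs; case: ltP.
exists s; [by rewrite !inE eqxx|rewrite xs /=].
by apply: (le_trans h1); apply: (le_trans (lerD (ltW xy') (lexx 1))); have := A_ge1; lra.
Qed.

Lemma anchors_height s p : s \in solutions F -> last s p \in solutions F ->
  anchors s != anchors (last s p) -> path (@hamming_adjacent n) s p ->
  T <= (height F (s :: p))%:R.
Proof.
move=> sS tS /(anchors_sep sS tS) [x ix h] sp.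
have far (z : R) : 3 * A < z -> (z < A) = false.
  by move=> Az; apply/negbTE; rewrite -leNgt; have := A_ge1; lra.
have [|y yp /andP[y1 y2]] := path_crossing (x := x) sp.
  by case: h => -[-> /far ->].
apply: le_trans (isolatedP ix y1 y2) _; rewrite ler_nat.
by rewrite /height; apply: leq_bigmax_seq.
Qed.

(** Adjacent solutions are at distance 1, less than the [2 * A] that separates solutions with
    different anchors. *)
Lemma anchors_connect s t : s \in solutions F ->
  connect (solution_adjacent F) s t -> t \in solutions F /\ anchors s = anchors t.
Proof.
move=> sS /connectP[p]; elim: p s sS => [|y p IH] s sS /=; first by move=> _ ->.
move=> /andP[/and3P[_ yS /eqP sy] py] tE.
have [tS <-] := IH _ yS py tE; split => //; apply/eqP; apply: contraT => /anchors_hamming.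
by move=> /(_ sS yS); rewrite sy; have := A_ge1; lra.
Qed.

Definition anchor_partition := preim_partition anchors (solutions F).

Lemma anchor_partitionP B : B \in anchor_partition ->
  exists2 s, s \in solutions F & B = [set t in solutions F | anchors s == anchors t].
Proof. by move=> /imsetP[s sS ->]; exists s. Qed.

Lemma anchor_region B : B \in anchor_partition -> is_region F B.
Proof.
move=> /anchor_partitionP[s sS ->]; split.
  by apply/set0Pn; exists s; rewrite inE sS eqxx.
exists [set C in clusters F | C \subset [set t in solutions F | anchors s == anchors t]].
split; first by apply/fintype.subsetP => C; rewrite inE => /andP[].
apply/setP => t; apply/idP/bigcupP => [|[C]]; last first.
  by rewrite inE => /andP[_ /fintype.subsetP]; apply.
rewrite [in X in X -> _]inE => /andP[tS st].
exists [set y in solutions F | connect (solution_adjacent F) t y]; last first.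
  by rewrite inE tS connect0.
rewrite inE; apply/andP; split; first by apply/imsetP; exists t.
apply/fintype.subsetP => y; rewrite inE => /andP[yS ty]; rewrite inE yS.
by have [_ <-] := anchors_connect tS ty.
Qed.

End Shattering.

(** A region with an anchor lies in the ball around it; the leftover region contains only
    non-isolated solutions. Small regions must be numerous, which is why [gamma] serves for both
    constants. *)
Lemma shattered_anchors (R : realType) (gamma a theta : R) (n : nat) (F : formula n) :
  1 <= a * n%:R -> 0 < theta * n%:R -> solutions F != set0 ->
  (forall s : assignment n, #|[set t | (hamming s t)%:R < a * n%:R]|%:R <=
     expR (- gamma * n%:R) * #|solutions F|%:R) ->
  #|[set s in solutions F | ~~ isolated F (a * n%:R) (theta * n%:R) s]|%:R <=
     expR (- gamma * n%:R) * #|solutions F|%:R ->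
  shattered gamma gamma a theta F.
Proof.
set A := a * n%:R; set T := theta * n%:R => A1 T0 S0 ball bad.
have partP := preim_partitionP (anchors F A T) (solutions F).
have small B : B \in anchor_partition F A T ->
    #|B|%:R <= expR (- gamma * n%:R) * #|solutions F|%:R.
  move=> /anchor_partitionP[s sS ->].
  (* An isolated solution anchors itself, since [A] is positive, so it is absent from the fibre over
     the empty set. *)
  have [E|/set0Pn[x]] := eqVneq (anchors F A T s) set0.
    apply: le_trans bad; rewrite ler_nat; apply: subset_leq_card.
    apply/fintype.subsetP => t; rewrite !inE E => /andP[tS /eqP tE].
    rewrite tS; apply/negP => it.
    by have := in_set0 t; rewrite tE !inE tS it hamming0 (lt_le_trans ltr01 A1).
  rewrite inE => xs.
  apply: le_trans (ball x); rewrite ler_nat; apply: subset_leq_card.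
  apply/fintype.subsetP => t; rewrite !inE => /andP[tS /eqP/setP/(_ x)].
  by rewrite !inE; move: xs; rewrite inE => -> /esym /and3P[].
have inP B s : B \in anchor_partition F A T -> s \in B ->
    s \in solutions F /\ B = [set t in solutions F | anchors F A T s == anchors F A T t].
  move=> /anchor_partitionP[x xS ->]; rewrite inE => /andP[sS /eqP xs].
  by rewrite xs.
have sep B C s t : B \in anchor_partition F A T -> C \in anchor_partition F A T ->
    B != C -> s \in B -> t \in C ->
    [/\ s \in solutions F, t \in solutions F & anchors F A T s != anchors F A T t].
  move=> BP CP BC /(inP _ _ BP)[sS Bs] /(inP _ _ CP)[tS Ct]; split => //.
  by apply: contraNneq BC => st; rewrite Bs Ct st.
exists (anchor_partition F A T); split => //.
- by split=> // B; apply: anchor_region.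
- have S1 : 0 < #|solutions F|%:R :> R by rewrite ltr0n card_gt0.
  (* Summing the size bound over all regions yields the lower bound on their number. *)
  have : #|solutions F|%:R <=
      #|anchor_partition F A T|%:R * (expR (- gamma * n%:R) * #|solutions F|%:R).
    rewrite [X in X%:R <= _](card_partition partP) natr_sum mulr_natl -sumr_const.
    by apply: ler_sum.
  rewrite mulrA -{1}[#|solutions F|%:R]mul1r ler_pM2r // mulNr expRN.
  by rewrite ler_pdivlMr ?expR_gt0 // mul1r.
- move=> B C BP CP BC s t sB tC; have [sS tS st] := sep _ _ _ _ BP CP BC sB tC.
  by have := anchors_hamming T0 sS tS st; rewrite -/A; lra.
- move=> B C BP CP BC s p sB tC sp; have [sS tS st] := sep _ _ _ _ BP CP BC sB tC.
  exact: anchors_height st sp.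
Qed.

(** * Transfer to sets of distinct clauses *)

Lemma imset_ffun_eq (T : finType) (k : nat) (C : {set T}) (f : {ffun 'I_k -> T}) :
  #|C| = k ->
  ([set f i | i : 'I_k] == C) = (f \in ffun_on (mem C)) && injectiveb f.
Proof.
move=> Ck; apply/eqP/andP => [fC|[/ffun_onP fC /injectiveP finj]].
  split; first by apply/ffun_onP => i; rewrite -fC imset_f.
  have : #|[set f i | i : 'I_k]| == #|'I_k| by rewrite fC Ck card_ord.
  by move=> /imset_injP inj; apply/injectiveP => i j; apply: inj.
apply/eqP; rewrite eqEcard card_imset // card_ord Ck leqnn andbT.
by apply/fintype.subsetP => _ /imsetP[i _ ->]; apply: fC.
Qed.

Lemma card_enumerations (T : finType) (k : nat) (C : {set T}) : #|C| = k ->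
  #|[set f : {ffun 'I_k -> T} | [set f i | i : 'I_k] == C]| = k`!.
Proof.
move=> Ck; rewrite -ffactnn -[X in (X ^_ _)%N]Ck -[X in (_ ^_ X)%N](card_ord k).
rewrite -[#|C|]/(#|mem C|) -card_inj_ffuns_on.
by apply: eq_card => f; rewrite !inE imset_ffun_eq.
Qed.

Lemma card_lifts (T U : finType) (m : nat) (h : T -> U) (g : 'I_m -> U) :
  #|[set w : {ffun 'I_m -> T} | [forall j, h (w j) == g j]]| =
  (\prod_j #|[set x | h x == g j]|)%N.
Proof.
transitivity (\prod_(j < m) \sum_(x : T) (h x == g j))%N; last first.
  apply: eq_bigr => j _; rewrite -sum1_card [RHS]big_mkcond.
  by apply: eq_bigr => x _; rewrite inE; case: eqP.
rewrite bigA_distr_bigA -sum1_card big_mkcond; apply: eq_bigr => w _.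
rewrite inE; case: ifP => [/forallP h1|/negbT].
  by rewrite big1 // => j _; rewrite h1.
rewrite negb_forall => /existsP[j /negPf hj].
by rewrite (bigD1 j) //= hj.
Qed.

Lemma card_fibers (T U : finType) (h : T -> U) (B : {set U}) (K : nat) :
  (forall y, y \in B -> #|[set x | h x == y]| = K) ->
  #|[set x | h x \in B]| = (#|B| * K)%N.
Proof.
move=> hB; rewrite -sum1_card (partition_big h (mem B)) /=; last by move=> x; rewrite inE.
rewrite -sum_nat_const; apply: eq_bigr => y yB; rewrite -(hB y yB) sum1_card.
apply: eq_card => x; rewrite !inE; apply/andP/eqP => [[_ /eqP]//|xy].
by rewrite inE xy eqxx.
Qed.

Section Transfer.
Variables (n k m : nat).

Definition clause_of (c : lclause n k) : clause n := [set c i | i : 'I_k].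

Definition formula_of (w : lformula n k m) : formula n :=
  [set clause_of (w j) | j : 'I_m].

Lemma violates_clause_of s c : violates s (clause_of c) = lviolates s c.
Proof.
apply/forallP/forallP => [h i|h l].
  by have /implyP := h (c i); apply; apply: imset_f.
by apply/implyP => /imsetP[i _ ->].
Qed.

Lemma solutions_formula_of w : solutions (formula_of w) = lsolutions w.
Proof.
apply/setP => s; rewrite !inE /energy cards_eq0; apply/eqP/forallP => [h j|h].
  rewrite -violates_clause_of; apply/negP => vj.
  have : clause_of (w j) \in set0 by rewrite -h inE vj andbT; apply: imset_f.
  by rewrite in_set0.
apply/setP => c; rewrite !inE; apply/negP => /andP[/imsetP[j _ ->]].
by rewrite violates_clause_of (negPf (h j)).
Qed.

(** Having [m] distinct clauses makes the indexing injective; otherwise a repeated clause would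
    count several times in [lenergy] but once in [energy]. *)
Lemma energy_formula_of w s : formula_of w \in kcnf n k m ->
  energy (formula_of w) s = lenergy w s.
Proof.
rewrite inE => /andP[_ /eqP Fm].
have /imset_injP inj : #|formula_of w| == #|'I_m| by rewrite Fm card_ord.
rewrite /energy /lenergy -(card_in_imset (f := fun j => clause_of (w j))).
  apply: eq_card => c; rewrite inE; apply/andP/imsetP => [[/imsetP[j _ ->]]|[j]].
    by rewrite violates_clause_of => vj; exists j => //; rewrite inE.
  by rewrite inE => vj ->; rewrite violates_clause_of; split=> //; apply: imset_f.
by move=> i j _ _; apply: inj.
Qed.

Lemma card_clause_of (C : clause n) : C \in kclauses n k ->
  #|[set c | clause_of c == C]| = k`!.
Proof. by rewrite inE => /andP[/eqP Ck _]; apply: card_enumerations. Qed.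

(** Each formula arises from the same number of sequences: [m!] orders of the clauses and [k!]
    orders inside each. Conditioned on landing in [kcnf], the independent model is therefore
    uniform. *)
Lemma card_formula_of (F : formula n) : F \in kcnf n k m ->
  #|[set w | formula_of w == F]| = (m`! * k`! ^ m)%N.
Proof.
rewrite inE => /andP[/fintype.subsetP Fk /eqP Fm].
pose h (w : lformula n k m) := [ffun j => clause_of (w j)].
rewrite -(card_enumerations Fm).
rewrite -(@card_fibers _ _ h [set f : {ffun 'I_m -> clause n} | [set f i | i : 'I_m] == F]).
  apply: eq_card => w; rewrite !inE /formula_of; congr (_ == _).
  by apply: eq_imset => j; rewrite ffunE.
move=> g; rewrite inE => /eqP gF.
transitivity #|[set w : lformula n k m | [forall j, clause_of (w j) == g j]]|.
  apply: eq_card => w; rewrite !inE; apply/eqP/forallP => [<- j|hw].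
    by rewrite ffunE.
  by apply/ffunP => j; rewrite ffunE; apply/eqP.
rewrite card_lifts (eq_bigr (fun=> k`!)) ?prod_nat_const ?card_ord // => j _.
by apply: card_clause_of; apply: Fk; rewrite -gF imset_f.
Qed.

Lemma card_formula_of_in (B : {set formula n}) : B \subset kcnf n k m ->
  #|[set w | formula_of w \in B]| = (#|B| * (m`! * k`! ^ m))%N.
Proof.
by move=> /fintype.subsetP Bk; apply: card_fibers => F /Bk; apply: card_formula_of.
Qed.

(** Sequences over distinct variables, with free signs, all yield k-clauses, and each clause comes
    from [k!] sequences. *)
Lemma card_kclauses_ge : (n ^_ k * 2 ^ k <= #|kclauses n k| * k`!)%N.
Proof.
rewrite -(card_fibers card_clause_of).
pose h (c : lclause n k) := [ffun i => (c i).1].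
rewrite -{1}(card_ord n) -{1}(card_ord k) -card_inj_ffuns -(@card_fibers _ _ h).
  apply: subset_leq_card; apply/fintype.subsetP => c; rewrite !inE => /injectiveP hinj.
  have e : [set l.1 | l in clause_of c] = [set h c i | i : 'I_k].
    apply/setP => v; apply/imsetP/imsetP => [[_ /imsetP[i _ ->] ->]|[i _ ->]].
      by exists i; rewrite ?ffunE.
    by exists (c i); rewrite ?ffunE //; apply: imset_f.
  rewrite e !card_imset ?card_ord ?eqxx // => i j cij.
  by apply: hinj; rewrite !ffunE cij.
move=> v _.
transitivity #|[set c : lclause n k | [forall i, (c i).1 == v i]]|.
  apply: eq_card => c; rewrite !inE; apply/eqP/forallP => [<- j|hw].
    by rewrite ffunE.
  by apply/ffunP => j; rewrite ffunE; apply/eqP.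
rewrite (card_lifts (fun l : literal n => l.1)) (eq_bigr (fun=> 2)).
  by rewrite prod_nat_const card_ord.
move=> i _; transitivity #|[set (v i, b) | b : bool]|; last first.
  by rewrite card_imset ?card_bool // => ? ? [].
apply: eq_card => -[j b]; rewrite inE /=; apply/eqP/imsetP => [->|[b' _ []]//].
by exists b.
Qed.

Lemma card_kcnf : #|kcnf n k m| = 'C(#|kclauses n k|, m).
Proof. exact: cards_draws. Qed.

Lemma ffact_ge a b : ((a - b) ^ b <= a ^_ b)%N.
Proof.
elim: b a => [|b IH] [|a] //=; first by rewrite exp0n.
by rewrite subSS expnS ffactSS; apply: leq_mul; [lia|exact: IH].
Qed.

Lemma card_nice_ge :
  (((n - k) ^ k * 2 ^ k - m * k`!) ^ m <= #|[set w | formula_of w \in kcnf n k m]|)%N.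
Proof.
rewrite card_formula_of_in // card_kcnf mulnA bin_ffact.
apply: leq_trans (_ : (#|kclauses n k| * k`! - m * k`!) ^ m <= _)%N.
  have [->|m0] := posnP m; first by rewrite !expn0.
  rewrite leq_exp2r // leq_sub2r //.
  by apply: leq_trans card_kclauses_ge; rewrite leq_mul2r ffact_ge orbT.
by rewrite -mulnBl expnMn leq_mul2r ffact_ge orbT.
Qed.

End Transfer.

(** On this range the inverse of [1 - x] is at most [1 + 2 * x]. *)
Lemma expR_ge_1Bx (R : realType) (x : R) : 0 <= x -> x <= 1 / 2 ->
  expR (- (2 * x)) <= 1 - x.
Proof.
move=> x0 x1; rewrite expRN invf_ple ?posrE ?expR_gt0 //; last lra.
apply: le_trans (expR_ge1Dx _); rewrite -[_^-1]div1r ler_pdivrMr; last by lra.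
by nra.
Qed.

Lemma bernoulli (R : realType) (x : R) k : 0 <= x -> x <= 1 ->
  1 - k%:R * x <= (1 - x) ^+ k.
Proof.
move=> x0 x1; elim: k => [|k IH]; first by rewrite mul0r subr0 expr0.
rewrite exprS -natr1; apply: le_trans (_ : (1 - x) * (1 - k%:R * x) <= _).
  have : 0 <= k%:R * x * x by rewrite !mulr_ge0.
  by nra.
by rewrite ler_wpM2l //; lra.
Qed.

(** Each of the [m] factors loses at most a fraction [C / n]: [k ^+ 2 / n] for repeated variables
    and [r * k! / n] for repeated clauses. As [m <= r * n], the product stays above a constant
    independent of [n]. *)
Lemma prob_nice_ge (R : realType) (n k m : nat) (r : R) :
  (2 <= k)%N -> (0 < n)%N -> 0 <= r -> m%:R <= r * n%:R ->
  let C : R := k%:R ^+ 2 + r * (k`!)%:R in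
  2 * C <= n%:R ->
  expR (- (2 * C * r)) <= prob R (fun w : lformula n k m => formula_of w \in kcnf n k m).
Proof.
move=> k2 n0 r0 mr C Cn.
have N0 : 0 < n%:R :> R by rewrite ltr0n.
have rf0 : 0 <= r * (k`!)%:R by rewrite mulr_ge0.
have kk : k%:R <= k%:R ^+ 2 :> R by rewrite -natrX ler_nat expnS expn1 leq_pmull //; lia.
have kn : (k <= n)%N by rewrite -(ler_nat R); rewrite /C in Cn; have := ler0n R k; lra.
have C0 : 0 <= C by rewrite /C addr_ge0 // sqr_ge0.
rewrite prob_card.
have -> : #|{: lformula n k m}|%:R = ((2 * n%:R) ^+ k) ^+ m :> R.
  by rewrite !card_ffun !card_ord card_literal !natrX natrM.
rewrite ler_pdivlMr; last by rewrite !exprn_gt0 // mulr_gt0.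
apply: le_trans (_ : (((n - k) ^ k * 2 ^ k - m * k`!) ^ m)%N%:R <= _); last first.
  rewrite ler_nat; apply: leq_trans (card_nice_ge n k m) _.
  by apply: subset_leq_card; apply/fintype.subsetP => w; rewrite inE.
rewrite natrX; set X := (_ - _)%N.
have XC : (1 - C / n%:R) * (2 * n%:R) ^+ k <= X%:R.
  apply: le_trans (_ : ((n - k) ^ k * 2 ^ k)%:R - (m * k`!)%:R <= _); last first.
    by rewrite lerBlDr -natrD ler_nat addnC -leq_subLR.
  rewrite !natrM !natrX natrB //.
  have -> : n%:R - k%:R = (1 - k%:R / n%:R) * n%:R :> R by rewrite mulrBl mul1r mulfVK ?gt_eqF.
  have b := @bernoulli R (k%:R / n%:R) k.
  have {}b : 1 - k%:R * (k%:R / n%:R) <= (1 - k%:R / n%:R) ^+ k :> R.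
    apply: b; first by rewrite divr_ge0.
    by rewrite ler_pdivrMr // mul1r ler_nat.
  have nk : n%:R ^+ 2 <= (2 * n%:R) ^+ k :> R.
    apply: le_trans (_ : (2 * n%:R) ^+ 2 <= _).
      by rewrite exprMn; have := sqr_ge0 (n%:R : R); lra.
    apply: ler_weXn2l => //; have : 1 <= n%:R :> R by rewrite ler1n.
    by lra.
  have mk : m%:R * (k`!)%:R <= r * (k`!)%:R / n%:R * (2 * n%:R) ^+ k.
    apply: le_trans (_ : r * (k`!)%:R / n%:R * n%:R ^+ 2 <= _).
      have -> : r * (k`!)%:R / n%:R * n%:R ^+ 2 = r * n%:R * (k`!)%:R by field; rewrite gt_eqF.
      by rewrite ler_wpM2r.
    by rewrite ler_wpM2l // divr_ge0.
  have p0 : 0 <= (2 * n%:R) ^+ k :> R by rewrite exprn_ge0 // mulr_ge0.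
  have := ler_wpM2r p0 b.
  have -> : (1 - k%:R / n%:R) ^+ k * (2 * n%:R) ^+ k =
     ((1 - k%:R / n%:R) * n%:R) ^+ k * 2 ^+ k :> R.
    by rewrite [(2 * _) ^+ k]exprMn [((1 - _) * _) ^+ k]exprMn; ring.
  move=> h.
  rewrite /C; apply: le_trans (lerB h mk); rewrite -mulrBl ler_wpM2r //.
  by rewrite le_eqVlt; apply/orP; left; apply/eqP; field; rewrite gt_eqF.
have Cn2 : C / n%:R <= 1 / 2 by rewrite ler_pdivrMr //; lra.
have Cn0 : 0 <= C / n%:R by rewrite divr_ge0.
apply: le_trans (_ : ((1 - C / n%:R) * (2 * n%:R) ^+ k) ^+ m <= _); last first.
  have Y0 : 0 <= (1 - C / n%:R) * (2 * n%:R) ^+ k.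
    by rewrite mulr_ge0 ?exprn_ge0 ?mulr_ge0 // subr_ge0; lra.
  by apply: lerXn2r; rewrite ?nnegrE.
rewrite [leRHS]exprMn ler_wpM2r ?exprn_ge0 ?mulr_ge0 //.
apply: le_trans (_ : expR (- (2 * (C / n%:R))) ^+ m <= _); last first.
  by apply: lerXn2r; rewrite ?nnegrE ?expR_ge0 ?expR_ge_1Bx //; lra.
rewrite -expRM_natl ler_expR mulrN lerN2.
have -> : m%:R * (2 * (C / n%:R)) = 2 * C * (m%:R / n%:R) by ring.
by rewrite ler_wpM2l ?mulr_ge0 // ler_pdivrMr.
Qed.

(** The uniform probability is the independent one conditioned on landing in [kcnf], an event of
    probability at least [c0]; a bound [e * c0] thus becomes [e]. *)
Lemma whp_kcnf_of_iid (R : realType) (k : nat) (r : R)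
    (E : forall n : nat, formula n -> Prop) :
  (2 <= k)%N -> 0 <= r ->
  (forall e : R, 0 < e -> exists N, forall n, (N <= n)%N ->
    prob R (fun w : lformula n k (Num.truncn (r * n%:R)) =>
      (formula_of w \in kcnf n k (Num.truncn (r * n%:R))) && ~~ `[< E n (formula_of w) >]) <= e) ->
  whp_kcnf k r E.
Proof.
move=> k2 r0 h; apply/cvgrPdist_le => e e0.
pose C : R := k%:R ^+ 2 + r * (k`!)%:R.
pose c0 := expR (- (2 * C * r)).
have c0p : 0 < c0 by apply: expR_gt0.
have [N hN] := h (e * c0) (mulr_gt0 e0 c0p).
exists (maxn N (maxn 1 (Num.truncn (2 * C)).+1)) => // n /=.
rewrite !geq_max => /and3P[Nn n0 Cn].
set m := Num.truncn (r * n%:R); set P := finset_uniform_prob _ _ _.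
have C0 : 0 <= 2 * C by rewrite !mulr_ge0 // addr_ge0 ?sqr_ge0 // mulr_ge0.
have mr : m%:R <= r * n%:R by rewrite truncn_le mulr_ge0.
have Cn' : 2 * C <= n%:R.
  have /andP[_ /ltW h1] := truncn_itv C0; apply: le_trans h1 _.
  by rewrite ler_nat.
have nice := prob_nice_ge k2 n0 r0 mr Cn'; rewrite -/c0 in nice.
pose B := [set F in kcnf n k m | ~~ `[< E n F >]].
pose K := (m`! * k`! ^ m)%N.
have K0 : 0 < K%:R :> R by rewrite ltr0n muln_gt0 expn_gt0 !fact_gt0.
have T0 : 0 < #|{: lformula n k m}|%:R :> R by rewrite ltr0n card_lformula_gt0.
have e1 : prob R (fun w : lformula n k m => formula_of w \in kcnf n k m) =
    #|kcnf n k m|%:R * K%:R / #|{: lformula n k m}|%:R.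
  rewrite prob_card -natrM -card_formula_of_in //; congr (_%:R / _).
  by apply: eq_card => w; rewrite inE.
have e2 : prob R (fun w : lformula n k m => (formula_of w \in kcnf n k m) &&
     ~~ `[< E n (formula_of w) >]) = #|B|%:R * K%:R / #|{: lformula n k m}|%:R.
  rewrite prob_card -natrM -card_formula_of_in; last first.
    by apply/fintype.subsetP => F; rewrite inE => /andP[].
  by congr (_%:R / _); apply: eq_card => w; rewrite [RHS]inE [RHS]inE.
have := hN n Nn; rewrite e2 => hB.
(* The positive lower bound [c0] excludes an empty [kcnf], for which the ratio would take its
   default value 0. *)
have k0 : 0 < #|kcnf n k m|%:R :> R.
  rewrite lt_neqAle ler0n andbT eq_sym; apply/eqP => z.
  by have := lt_le_trans c0p nice; rewrite e1 z !mul0r ltxx.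
have PB : 1 - P = #|B|%:R / #|kcnf n k m|%:R.
  rewrite /P /finset_uniform_prob.
  have -> : #|B|%:R = #|kcnf n k m|%:R -
      #|[set x in kcnf n k m | `[< E n x >]]|%:R :> R.
    apply/eqP; rewrite -subr_eq0 opprB addrA subr_eq0 eq_sym -natrD eqr_nat.
    rewrite -(cardsID [set x | `[< E n x >]] (kcnf n k m)) addnC.
    by apply/eqP; congr addn; apply: eq_card => x; rewrite !inE // andbC.
  by rewrite mulrBl mulfV ?gt_eqF.
rewrite ger0_norm PB ?divr_ge0 // ler_pdivrMr //.
move: hB nice; rewrite e1 ler_pdivrMr // ler_pdivlMr // => hB nice.
rewrite -(ler_pM2r K0); apply: le_trans hB _.
by rewrite -!mulrA ler_pM2l.
Qed.

(** * The second moment *)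

(** Both exponentials are bounded by [(1 - y)^-1], and the two bounds add up to
    [2 / (1 - x ^+ 2)]. *)
Lemma cosh_le (R : realType) (x : R) : x ^+ 2 <= 1 / 2 ->
  expR x + expR (- x) <= 2 * expR (2 * x ^+ 2).
Proof.
move=> x2.
have x1 : -1 < x < 1 by apply/andP; split; nra.
have x20 := sqr_ge0 x.
have inv (y : R) : -1 < y < 1 -> expR y <= (1 - y)^-1.
  move=> y1; rewrite -[expR y]invrK lef_pV2 ?posrE ?invr_gt0 ?expR_gt0 //; last lra.
  by rewrite -expRN; apply: le_trans (expR_ge1Dx _); lra.
apply: le_trans (lerD (inv x x1) (inv (- x) _)) _; first lra.
have -> : (1 - x)^-1 + (1 - - x)^-1 = 2 * (1 - x ^+ 2)^-1.
  by field; apply/and3P; split; apply/eqP; nra.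
rewrite ler_pM2l // -[leRHS]invrK lef_pV2 ?posrE ?invr_gt0 ?expR_gt0 //; last lra.
by rewrite -expRN; apply: expR_ge_1Bx.
Qed.

(** * Sizes of Hamming spheres *)

Section Shells.
Variables (R : realType) (n : nat).
Hypothesis n_gt0 : (0 < n)%N.
Implicit Types s t : assignment n.

Lemma hamming_le s t : (hamming s t <= n)%N.
Proof. by rewrite -[leqRHS]card_ord; apply: max_card. Qed.

Definition shell s (z : nat) : {set assignment n} := [set t | hamming s t == z].

Lemma card_shell_le s z (y : R) : 0 < y -> #|shell s z|%:R * y ^+ z <= (1 + y) ^+ n.
Proof.
move=> y0; rewrite -(sum_expr_hamming s) (bigID (mem (shell s z))) /=.
rewrite [X in _ <= X + _](eq_bigr (fun=> y ^+ z)) => [|t]; last first.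
  by rewrite inE => /eqP ->.
rewrite sumr_const mulr_natl lerDl; apply: sumr_ge0 => t _.
by rewrite exprn_ge0 // ltW.
Qed.

(** With [y = expR (- (b * u))] the terms linear in [u] cancel and the exponent is
    [- n u^2 b (1 - b) / 2]; the choice [b = 1 / 2] is the best one and gives the constant 8. *)
Lemma card_shell_hoeffding s z : let u := 1 - 2 * z%:R / n%:R in
  `|u| <= 1 -> #|shell s z|%:R <= 2 ^+ n * expR (- (n%:R * u ^+ 2 / 8)) :> R.
Proof.
move=> u u1.
have N0 : 0 < n%:R :> R by rewrite ltr0n.
have u2 : u ^+ 2 <= 1 by rewrite -(real_normK (num_real u)) exprn_ile1.
pose y := expR (- (u / 2)).
have := card_shell_le s z (expR_gt0 (- (u / 2))); rewrite -/y => h.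
rewrite -(ler_pM2r (exprn_gt0 z (expR_gt0 (- (u / 2))))) -/y.
apply: le_trans h _.
have y1 : 1 + y <= 2 * expR (2 * (u / 4) ^+ 2) * expR (- (u / 4)).
  apply: le_trans (_ : (expR (u / 4) + expR (- (u / 4))) * expR (- (u / 4)) <= _).
    rewrite mulrDl -!expRD addrN expR0 -opprD -mulrDr /y.
    by apply: lerD => //; rewrite ler_expR; lra.
  by rewrite ler_pM2r ?expR_gt0 // cosh_le // expr_div_n; lra.
apply: le_trans (lerXn2r n _ _ y1) _; rewrite ?nnegrE ?addr_ge0 ?mulr_ge0 ?expR_ge0 //.
rewrite !exprMn -!mulrA ler_pM2l ?exprn_gt0 // /y -!expRM_natl -!expRD ler_expR.
have zE : z%:R = n%:R * (1 - u) / 2 by rewrite /u; field; rewrite gt_eqF.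
by rewrite zE; lra.
Qed.

Lemma sum_shells s (F : nat -> R) :
  \sum_t F (hamming s t) = \sum_(z < n.+1) #|shell s z|%:R * F z.
Proof.
rewrite (partition_big (fun t => inord (hamming s t) : 'I_n.+1) xpredT) //=.
apply: eq_bigr => z _; rewrite mulr_natl -sumr_const; apply: eq_big => t.
  by rewrite inE -val_eqE /= inordK // ltnS hamming_le.
by move=> /eqP <-; rewrite inordK // ltnS hamming_le.
Qed.

End Shells.

(** * Bounds on the pair correlation *)

Section Correlation.
Variables (R : realType) (k : nat).
Hypothesis k_large : 10 ^+ 6 <= k%:R :> R.

Let k_ge : (100 <= k)%N.
Proof. by rewrite -(ler_nat R); have := k_large; lra. Qed.

Lemma triples_ge : k%:R <= 4 * (k %/ 3)%:R :> R.
Proof. by rewrite -natrM ler_nat; have := k_ge; lia. Qed.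

Let M : R := (k %/ 3)%:R.

Let M_gt0 : 0 < M.
Proof. by rewrite /M ltr0n; have := k_ge; lia. Qed.

Let k_gt : 10 ^+ 6 <= k%:R :> R := k_large.

Lemma inv_triples_le : M^-1 <= 4 / k%:R.
Proof.
have K0 : 0 < k%:R :> R by have := k_gt; lra.
rewrite ler_pdivlMr // mulrC ler_pdivrMr //.
exact: triples_ge.
Qed.

Lemma inv_triples_le16 : M^-1 <= 1 / 16.
Proof.
apply: le_trans inv_triples_le _; have K0 := k_gt.
by rewrite ler_pdivrMr; lra.
Qed.

Lemma correlation_norm (u : R) : `|u| <= 1 ->
  `|correlation k u| <= 8 / M * `|u| ^+ 3 * ((1 + u) / 2) ^+ (k - 3) +
    (1 - M^-1) * `|u| ^+ 6 * ((1 + u) / 2) ^+ (k - 6).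
Proof.
move=> u1; have v0 : 0 <= (1 + u) / 2 by have := ler_norm (- u); rewrite normrN; lra.
have m0 : 0 < M^-1 by rewrite invr_gt0.
have m1 : 0 <= 1 - M^-1 by have := inv_triples_le16; lra.
rewrite /correlation -/M; apply: le_trans (ler_normD _ _) _.
have p3 := exprn_ge0 (k - 3) v0; have p6 := exprn_ge0 (k - 6) v0.
rewrite !normrM !normrX (ger0_norm v0) (ger0_norm m1) !mulrA.
by rewrite (ger0_norm (ltW m0)) (ger0_norm (_ : 0 <= 8 :> R)).
Qed.

(** For typical pairs, of overlap about [n^(-1/2)]: the exponent [n * |u|^3] is then negligible. *)
Lemma correlation_cubic (u : R) : `|u| <= 1 -> `|correlation k u| <= 2 * `|u| ^+ 3.
Proof.
move=> u1; apply: le_trans (correlation_norm u1) _.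
have v0 : 0 <= (1 + u) / 2 by have := ler_norm (- u); rewrite normrN; lra.
have v1 : (1 + u) / 2 <= 1 by have := ler_norm u; lra.
have a0 := normr_ge0 u.
have a3 := exprn_ge0 3 a0.
have a6 : `|u| ^+ 6 <= `|u| ^+ 3 by rewrite ler_wiXn2l.
have m0 : 0 < M^-1 by rewrite invr_gt0.
have m1 := inv_triples_le16.
have p3 := exprn_ile1 (k - 3) v0 v1; have p6 := exprn_ile1 (k - 6) v0 v1.
have q3 := exprn_ge0 (k - 3) v0; have q6 := exprn_ge0 (k - 6) v0.
apply: le_trans (_ : 8 / M * `|u| ^+ 3 * 1 + (1 - M^-1) * `|u| ^+ 3 * 1 <= _).
  apply: lerD; first by rewrite ler_wpM2l // mulr_ge0 // mulr_ge0 // ltW.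
  apply: ler_pM => //; first by rewrite mulr_ge0 ?exprn_ge0 //; lra.
  by rewrite ler_wpM2l //; lra.
rewrite !mulr1 -mulrDl ler_wpM2r //.
by lra.
Qed.

(** For pairs close to each other. The total coefficient is [1 + 7 / M], and [M] is at least
    [k / 4]. *)
Lemma correlation_le1 (u : R) : `|u| <= 1 -> `|correlation k u| <= 1 + 28 / k%:R.
Proof.
move=> u1; apply: le_trans (correlation_norm u1) _.
have v0 : 0 <= (1 + u) / 2 by have := ler_norm (- u); rewrite normrN; lra.
have v1 : (1 + u) / 2 <= 1 by have := ler_norm u; lra.
have a0 := normr_ge0 u.
have m0 : 0 < M^-1 by rewrite invr_gt0.
have m1 := inv_triples_le16; have m2 := inv_triples_le.
apply: le_trans (_ : 8 / M * 1 * 1 + (1 - M^-1) * 1 * 1 <= _); last lra.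
have e3 := exprn_ile1 3 a0 u1; have e6 := exprn_ile1 6 a0 u1.
have p3 := exprn_ile1 (k - 3) v0 v1; have p6 := exprn_ile1 (k - 6) v0 v1.
have q3 := exprn_ge0 (k - 3) v0; have q6 := exprn_ge0 (k - 6) v0.
apply: lerD; apply: ler_pM => //; try (by rewrite mulr_ge0 ?exprn_ge0 //; lra);
  by rewrite ler_wpM2l //; lra.
Qed.

(** For intermediate overlaps, where the power is tiny because [u] is bounded away from 1 on the
    scale [1 / k]. *)
Lemma correlation_small (u : R) : `|u| <= 1 ->
  `|correlation k u| <= 32 / k%:R + ((1 + u) / 2) ^+ (k - 6).
Proof.
move=> u1; apply: le_trans (correlation_norm u1) _.
have v0 : 0 <= (1 + u) / 2 by have := ler_norm (- u); rewrite normrN; lra.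
have v1 : (1 + u) / 2 <= 1 by have := ler_norm u; lra.
have a0 := normr_ge0 u.
have m0 : 0 < M^-1 by rewrite invr_gt0.
have m1 := inv_triples_le16; have m2 := inv_triples_le.
have e3 := exprn_ile1 3 a0 u1; have e6 := exprn_ile1 6 a0 u1.
have f3 := exprn_ge0 3 a0; have f6 := exprn_ge0 6 a0.
have p3 := exprn_ile1 (k - 3) v0 v1; have p6 := exprn_ile1 (k - 6) v0 v1.
have q3 := exprn_ge0 (k - 3) v0; have q6 := exprn_ge0 (k - 6) v0.
apply: lerD.
  apply: le_trans (_ : 8 / M * 1 * 1 <= _); last by lra.
  apply: ler_pM => //; first by rewrite mulr_ge0 //; lra.
  by rewrite ler_wpM2l //; lra.
rewrite ler_piMl //; apply: le_trans (_ : 1 * 1 <= _); last by rewrite mulr1.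
by apply: ler_pM => //; lra.
Qed.

End Correlation.

Lemma expR1_ge2 (R : realType) : 2 <= expR 1 :> R.
Proof. by apply: le_trans (expR_ge1Dx 1); lra. Qed.

Lemma expr_1Dx_le (R : realType) (x : R) m : 0 <= 1 + x ->
  (1 + x) ^+ m <= expR (m%:R * x).
Proof. by move=> x0; rewrite expRM_natl lerXn2r ?nnegrE ?expR_ge0 // expR_ge1Dx. Qed.

(** * Concentration of the partition function *)

Section SecondMoment.
Variables (R : realType) (n k m : nat) (rho eta : R).
Hypothesis n_gt0 : (0 < n)%N.
Hypothesis k_large : 10 ^+ 6 <= k%:R :> R.
Hypothesis rho_ge0 : 0 <= rho.
Hypothesis rho_le1 : rho <= 1.
Hypothesis eta_gt0 : 0 < eta.
Hypothesis eta_le : eta <= 1 / 16.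
Hypothesis m_le : m%:R * 2 ^- k <= rho * n%:R.
Hypothesis gap : rho * (1 + 28 / k%:R) + (1 + 20 * ln k%:R) / k%:R + eta <= ln 2.

Let ov (z : nat) : R := 1 - 2 * z%:R / n%:R.

Let N0 : 0 < n%:R :> R. Proof. by rewrite ltr0n. Qed.
Let K0 : 0 < k%:R :> R. Proof. by apply: lt_le_trans k_large; lra. Qed.

Let ov_le1 z : (z <= n)%N -> `|ov z| <= 1.
Proof.
move=> zn; have z1 : z%:R / n%:R <= 1 :> R by rewrite ler_pdivrMr // mul1r ler_nat.
have z0 : 0 <= z%:R / n%:R :> R by rewrite divr_ge0.
by rewrite ler_norml /ov -mulrA; apply/andP; split; lra.
Qed.

Let mu_ge0 : 0 <= m%:R * 2 ^- k :> R.
Proof. by rewrite mulr_ge0 // invr_ge0 exprn_ge0. Qed.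

Lemma shell_near (s : assignment n) z : (z <= n)%N -> z%:R * k%:R <= 20 * n%:R :> R ->
  #|shell s z|%:R * expR (m%:R * 2 ^- k * `|correlation k (ov z)|) <=
  2 ^+ n * expR (- (eta * n%:R * ov z ^+ 2)).
Proof.
move=> zn zk.
have k1 : 0 < k%:R^-1 :> R by rewrite invr_gt0.
have l0 : 0 <= ln k%:R :> R by rewrite ln_ge0 //; have := k_large; lra.
have kE : k%:R^-1 ^+ z = expR (- (z%:R * ln k%:R)) :> R.
  by rewrite -mulrN expRM_natl -lnV ?posrE // lnK ?posrE.
have c1 : #|shell s z|%:R <= expR (n%:R * ((1 + 20 * ln k%:R) / k%:R)) :> R.
  have := card_shell_le s z k1; rewrite kE expRN ler_pdivrMr ?expR_gt0 // => h.
  apply: le_trans h _; apply: le_trans (_ : expR (n%:R * k%:R^-1) * expR (z%:R * ln k%:R) <= _).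
    by rewrite ler_pM2r ?expR_gt0 // expr_1Dx_le // addr_ge0 // ltW.
  rewrite -expRD ler_expR mulrDl mulrDr mul1r lerD2l.
  apply: le_trans (_ : 20 * n%:R / k%:R * ln k%:R <= _).
    by rewrite ler_wpM2r // ler_pdivlMr.
  by rewrite le_eqVlt; apply/orP; left; apply/eqP; ring.
have c2 : m%:R * 2 ^- k * `|correlation k (ov z)| <= rho * n%:R * (1 + 28 / k%:R).
  by apply: ler_pM => //; apply: correlation_le1 => //; apply: ov_le1.
have c3 : expR (n%:R * ln 2) = 2 ^+ n :> R by rewrite expRM_natl lnK ?posrE.
have c4 : ov z ^+ 2 <= 1.
  by rewrite -(real_normK (num_real _)) exprn_ile1 // ov_le1.
apply: le_trans (ler_pM _ _ c1 (_ : _ <= expR (rho * n%:R * (1 + 28 / k%:R)))) _;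
  rewrite ?expR_ge0 ?ler_expR // -c3 -!expRD ler_expR.
have g := ler_wpM2l (ltW N0) gap.
have := ler_wpM2l (mulr_ge0 (ltW eta_gt0) (ltW N0)) c4.
by nra.
Qed.

(** The correlation costs at most [u^2 / 16] per variable, half of the Hoeffding gain [u^2 / 8]; the
    other half covers [eta]. *)
Lemma shell_far (s : assignment n) z : (z <= n)%N -> 20 * n%:R < z%:R * k%:R :> R ->
  #|shell s z|%:R * expR (m%:R * 2 ^- k * `|correlation k (ov z)|) <=
  2 ^+ n * expR (- (eta * n%:R * ov z ^+ 2)).
Proof.
move=> zn zk; have u1 := ov_le1 zn.
have u20 := sqr_ge0 (ov z).
have nu : `|ov z| ^+ 2 = ov z ^+ 2 by rewrite real_normK ?num_real.
have cor : `|correlation k (ov z)| <= ov z ^+ 2 / 16.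
  (* Below 1/32 the cubic bound suffices. Above it, [u^2 / 16] is at least [2^-14], more than
     [32 / 10^6 + 2^-19]. *)
  have [us|ul] := leP `|ov z| (1 / 32).
    apply: le_trans (correlation_cubic k_large u1) _.
    by rewrite exprS nu; nra.
  apply: le_trans (correlation_small k_large u1) _.
  have v1 : (1 + ov z) / 2 <= expR (- (20 / k%:R)).
    apply: le_trans (_ : 1 - 20 / k%:R <= _); last by apply: expR_ge1Dx.
    have -> : (1 + ov z) / 2 = 1 - z%:R / n%:R by rewrite /ov; field; rewrite gt_eqF.
    by rewrite lerD2l lerN2 ler_pdivlMr // mulrAC ler_pdivrMr // ltW.
  have v0 : 0 <= (1 + ov z) / 2.
    by have := ler_norm (- ov z); rewrite normrN; lra.
  have v2 : ((1 + ov z) / 2) ^+ (k - 6) <= 1 / 2 ^+ 19.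
    apply: le_trans (lerXn2r (k - 6) _ _ v1) _; rewrite ?nnegrE ?expR_ge0 //.
    rewrite -expRM_natl -[_ / _]mul1r mul1r div1r.
    apply: le_trans (_ : expR (- 19) <= _).
      rewrite ler_expR mulrN lerN2 mulrA ler_pdivlMr // natrB; last first.
        by rewrite -(ler_nat R); have := k_large; lra.
      by have := k_large; lra.
    rewrite expRN lef_pV2 ?posrE ?expR_gt0 ?exprn_gt0 //.
    rewrite -[19](mulr1 19) expRM_natl.
    by rewrite lerXn2r ?nnegrE ?expR_ge0 ?expR1_ge2.
  have k32 : 32 / k%:R <= 32 / 10 ^+ 6 :> R.
    by rewrite ler_pM2l // lef_pV2 ?posrE // exprn_gt0.
  have u2 : (1 / 32) ^+ 2 <= ov z ^+ 2 by rewrite -nu lerXn2r ?nnegrE ?divr_ge0 // ltW.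
  by lra.
have hoef := card_shell_hoeffding n_gt0 s u1.
rewrite -/(ov z) in hoef.
apply: le_trans (ler_wpM2r (expR_ge0 _) hoef) _.
rewrite -[leLHS]mulrA ler_pM2l ?exprn_gt0 // -expRD ler_expR.
have c2 : m%:R * 2 ^- k * `|correlation k (ov z)| <= n%:R * (ov z ^+ 2 / 16).
  apply: ler_pM => //; apply: le_trans m_le _.
  by rewrite ler_piMl // ltW.
have : 0 <= n%:R * ov z ^+ 2 by rewrite mulr_ge0.
have := ler_wpM2r (_ : 0 <= n%:R * ov z ^+ 2) eta_le.
move=> h h'; have := h h'; lra.
Qed.

Lemma shell_bound (s : assignment n) z : (z <= n)%N ->
  #|shell s z|%:R * expR (m%:R * 2 ^- k * `|correlation k (ov z)|) <=
  2 ^+ n * expR (- (eta * n%:R * ov z ^+ 2)).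
Proof.
move=> zn; have [h|h] := leP (z%:R * k%:R) (20 * n%:R : R).
  exact: shell_near.
exact: shell_far.
Qed.

(** Writing [y = n u^2], the hypothesis gives [y^3 >= n delta^2]. The sixth power of [y] then yields
    [n^2], enough to beat the [n + 1] shells. *)
Lemma expR_decay (delta u : R) : 0 < delta -> delta < n%:R * `|u| ^+ 3 ->
  expR (- (eta * n%:R * u ^+ 2)) <= 6 ^+ 6 / (eta ^+ 6 * (n%:R ^+ 2 * delta ^+ 4)).
Proof.
move=> d0 du.
have y3 : (n%:R * u ^+ 2) ^+ 3 = n%:R * (n%:R * `|u| ^+ 3) ^+ 2.
  have -> : u ^+ 2 = `|u| ^+ 2 by rewrite real_normK ?num_real.
  by ring.
set y := n%:R * u ^+ 2 in y3.
have y0 : 0 <= y by rewrite mulr_ge0 ?sqr_ge0.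
have y6 : n%:R ^+ 2 * delta ^+ 4 <= y ^+ 6.
  have -> : y ^+ 6 = (y ^+ 3) ^+ 2 by ring.
  rewrite y3 exprMn ler_pM2l ?exprn_gt0 //.
  have -> : delta ^+ 4 = (delta ^+ 2) ^+ 2 by ring.
  have d2 : delta ^+ 2 <= (n%:R * `|u| ^+ 3) ^+ 2.
    by rewrite lerXn2r ?nnegrE // ?ltW // (lt_trans d0).
  by rewrite lerXn2r ?nnegrE ?sqr_ge0.
have y6p : 0 < n%:R ^+ 2 * delta ^+ 4 by rewrite mulr_gt0 ?exprn_gt0.
have e6 : (eta * y / 6) ^+ 6 <= expR (eta * y).
  have -> : eta * y = 6 * (eta * y / 6) by field.
  set x := eta * y / 6; rewrite [expR _]expRM_natl.
  have x0 : 0 <= x by rewrite /x divr_ge0 // mulr_ge0 // ltW.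
  have -> : 6 * x / 6 = x by field.
  rewrite lerXn2r ?nnegrE ?expR_ge0 //.
  by apply: le_trans (expR_ge1Dx _); lra.
rewrite expRN -mulrA -/y -[leRHS]invrK lef_pV2 ?posrE ?expR_gt0 //; last first.
  by rewrite invr_gt0 divr_gt0 ?exprn_gt0 // mulr_gt0 // exprn_gt0.
apply: le_trans e6; rewrite invf_div expr_div_n exprMn ler_pM2r ?invr_gt0 ?exprn_gt0 //.
by rewrite ler_pM2l // exprn_gt0.
Qed.

Lemma sum_correlation_le (delta : R) (s : assignment n) : 0 < delta ->
  \sum_(t : assignment n) (1 + 2 ^- k * correlation k (overlap R s t)) ^+ m <=
  2 ^+ n * (expR (2 * delta) +
    n.+1%:R * (6 ^+ 6 / (eta ^+ 6 * (n%:R ^+ 2 * delta ^+ 4)))).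
Proof.
move=> d0.
set D := 6 ^+ 6 / _.
have D0 : 0 <= D by rewrite divr_ge0 ?exprn_ge0 // !mulr_ge0 ?exprn_ge0 // ltW.
(* Here [near] means overlap near 0, the bulk of all pairs; each such term is at most
   [expR (2 * delta)]. *)
pose near z := n%:R * `|ov z| ^+ 3 <= delta.
pose G z : R := expR (m%:R * 2 ^- k * `|correlation k (ov z)|).
have p2 : 0 < 2 ^- k :> R by rewrite invr_gt0 exprn_gt0.
have p2' : 2 ^- k <= 1 / 2 :> R.
  rewrite div1r lef_pV2 ?posrE ?exprn_gt0 // -{1}[2]expr1 ler_weXn2l //; first lra.
  by rewrite -(ler_nat R); have := k_large; lra.
apply: le_trans (_ : \sum_(t : assignment n)
   (expR (2 * delta) + (~~ near (hamming s t))%:R * G (hamming s t)) <= _).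
  apply: ler_sum => t _; have un := ov_le1 (hamming_le s t).
  have cub := correlation_cubic k_large un.
  rewrite /overlap -/(ov _); set z := hamming s t in un cub *.
  have a3 : `|ov z| ^+ 3 <= 1 by rewrite exprn_ile1.
  have a30 : 0 <= `|ov z| ^+ 3 by rewrite exprn_ge0.
  have [l1 l2] := (ler_norm (correlation k (ov z)), ler_norm (- correlation k (ov z))).
  rewrite normrN in l2.
  have pos : 0 <= 1 + 2 ^- k * correlation k (ov z) by nra.
  have step : (1 + 2 ^- k * correlation k (ov z)) ^+ m <= G z.
    apply: le_trans (expr_1Dx_le m pos) _; rewrite /G ler_expR mulrA ler_wpM2l //.
  apply: le_trans step _; have [nz|fz] := boolP (near z); last first.
    by rewrite mul1r lerDr expR_ge0.
  rewrite mul0r addr0 /G ler_expR.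
  apply: le_trans (ler_pM _ _ m_le cub) _ => //.
  have nz' : n%:R * `|ov z| ^+ 3 <= delta by [].
  have : 0 <= n%:R * `|ov z| ^+ 3 by rewrite mulr_ge0.
  by have := rho_le1; have := rho_ge0; nra.
rewrite big_split /= sumr_const card_assignment -[X in X + _]mulr_natl natrX mulrDr lerD2l.
rewrite (sum_shells s (fun z => (~~ near z)%:R * G z)).
apply: le_trans (_ : \sum_(z < n.+1) 2 ^+ n * D <= _); last first.
  by rewrite sumr_const card_ord -[X in X <= _]mulr_natl mulrCA.
apply: ler_sum => z _; have zn : (z <= n)%N by rewrite -ltnS.
have [nz|fz] /= := boolP (near z).
  by rewrite mul0r mulr0 mulr_ge0 // exprn_ge0.
rewrite mul1r; apply: le_trans (shell_bound s zn) _; rewrite ler_pM2l ?exprn_gt0 //.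
by apply: expR_decay => //; rewrite ltNge.
Qed.

Lemma prob_partition_function_small (delta : R) : 0 < delta ->
  prob R (fun w : lformula n k m => partition_function R w <= 2 ^+ n / 2) <=
  4 * (expR (2 * delta) - 1 +
    n.+1%:R * (6 ^+ 6 / (eta ^+ 6 * (n%:R ^+ 2 * delta ^+ 4)))).
Proof.
move=> d0; have k6 : (6 <= k)%N by rewrite -(ler_nat R); have := k_large; lra.
have p0 : 0 < 2 ^+ n :> R by rewrite exprn_gt0.
have T0 : (0 < #|{: lformula n k m}|)%N by apply: card_lformula_gt0.
have := chebyshev_avg T0 p0 (avg_partition_function R m n_gt0 k6).
move=> h; apply: le_trans h _.
rewrite ler_pM2l // -addrAC lerD2r avg_partition_function_sqr //.
rewrite ler_pdivrMr ?exprn_gt0 //.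
apply: le_trans (ler_sum _ (fun s _ => sum_correlation_le s d0)) _.
rewrite sumr_const card_assignment -[X in X <= _]mulr_natl natrX.
by rewrite le_eqVlt; apply/orP; left; apply/eqP; ring.
Qed.

End SecondMoment.

(** * Pairs of nearby solutions *)

(** In the application [x / k] is the flipped fraction, [I = 1 / k] and [V = (1 - x / k) ^ k]. [W]
    is the energy cost of the pair, net of the loss [28 / k] in the lower bound on the number of
    solutions. *)
Lemma energy_factor_bounds (R : realType) (c x I V : R) :
  0 < c -> c <= 1 / 10 -> c <= x -> x <= 3 * c -> 0 < I -> I <= c * c / 10 ^+ 4 ->
  0 <= V -> x * (1 - 3 * c) <= 1 - V ->
  let W := (1 - I) * (1 - V) - 28 * I in
  [/\ x * (1 - 31 / 10 * c) <= W, 0 <= W & W <= 1].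
Proof.
move=> c0 c1 x1 x2 I0 I1 V0 xV W.
have x0 : 0 <= x by lra.
have V1 : V <= 1.
  by rewrite -subr_ge0; apply: le_trans xV; apply: mulr_ge0; lra.
have cc : c * c <= c * x by rewrite ler_pM2l.
have I1' : 28 * I <= 28 / 10 ^+ 4 * (c * x) by lra.
have I1l : I <= 1 by nra.
have I2 : I * (x * (1 - 3 * c)) <= I * 1.
  by rewrite ler_pM2l //; apply: le_trans xV _; lra.
have I3 : (1 - I) * (x * (1 - 3 * c)) <= (1 - I) * (1 - V).
  by rewrite ler_wpM2l //; lra.
have e : (1 - I) * (x * (1 - 3 * c)) = x - 3 * (c * x) - I * (x * (1 - 3 * c)) by ring.
have W1 : x * (1 - 31 / 10 * c) <= W.
  have -> : x * (1 - 31 / 10 * c) = x - 31 / 10 * (c * x) by ring.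
  by rewrite /W; lra.
split => //; first by apply: le_trans W1; apply: mulr_ge0; lra.
have : 0 <= I * (1 - V) by apply: mulr_ge0; lra.
by rewrite /W mulrBl mul1r; lra.
Qed.

Section NearPairs.
Variables (R : realType) (k : nat) (c rho : R).
Hypothesis c_gt0 : 0 < c.
Hypothesis c_le : c <= 1 / 10.
Hypothesis c_ln : 1 - ln c <= c * ln k%:R.
Hypothesis k_large : 10 ^+ 3 * ln k%:R <= c ^+ 2 * k%:R.
Hypothesis rho_ge : (1 + 10 * c) * (ln k%:R / k%:R) <= rho.
Hypothesis rho_le : rho <= (1 - 10 * c) * ln 2.

Lemma ln2_bounds : 1 / 2 <= ln (2 : R) <= 1.
Proof.
apply/andP; split; last first.
  have := @le_ln1Dx R 1 _; have -> : 1 + 1 = 2 :> R by lra.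
  by apply; lra.
rewrite -ler_expR lnK ?posrE // -[leLHS]invrK -[leRHS]invrK lef_pV2 ?posrE ?invr_gt0 ?expR_gt0 //.
by rewrite -expRN; apply: le_trans (expR_ge1Dx _); lra.
Qed.

Lemma lnc_lt0 : ln c < 0. Proof. by apply: ln_lt0; rewrite c_gt0 /=; have := c_le; lra. Qed.

Lemma lnk_ge10 : 10 <= ln k%:R :> R.
Proof.
have h1 := c_ln; have h2 := lnc_lt0; have h3 := c_le; have h4 := c_gt0.
rewrite leNgt; apply/negP => h.
have : c * ln k%:R < c * 10 by rewrite ltr_pM2l.
by lra.
Qed.

Lemma k_ge_million : 10 ^+ 6 <= k%:R :> R.
Proof.
have h1 := k_large; have h2 := lnk_ge10; have h3 := c_le; have h4 := c_gt0.
have c2 : c ^+ 2 <= 1 / 100 by nra.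
have k0 : 0 <= k%:R :> R by [].
by nra.
Qed.

Lemma k_gt0_real : 0 < k%:R :> R. Proof. by have := k_ge_million; lra. Qed.

(* Exponential rate, up to a constant, of the fraction of non-isolated solutions. *)
Definition rate : R := c ^+ 2 * (ln k%:R / k%:R).

Lemma lnkk_gt0 : 0 < ln k%:R / k%:R :> R.
Proof. by rewrite divr_gt0 ?k_gt0_real //; have := lnk_ge10; lra. Qed.

Lemma rate_gt0 : 0 < rate.
Proof. by rewrite /rate mulr_gt0 ?lnkk_gt0 ?exprn_gt0. Qed.

Lemma invk_le : k%:R^-1 <= (ln k%:R / k%:R) / 10 :> R.
Proof.
have k1 : 0 < k%:R^-1 :> R by rewrite invr_gt0 k_gt0_real.
by have := lnk_ge10; nra.
Qed.

Lemma lnkk_le : 10 ^+ 3 * (ln k%:R / k%:R) <= c ^+ 2.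
Proof. by rewrite mulrA ler_pdivrMr ?k_gt0_real. Qed.

Lemma density_ge0 : 0 <= rho.
Proof.
apply: le_trans rho_ge; rewrite mulr_ge0 ?(ltW lnkk_gt0) //.
by have := c_gt0; lra.
Qed.

Lemma density_le1 : rho <= 1.
Proof.
apply: le_trans rho_le _; have /andP[l1 l2] := ln2_bounds.
by have := c_gt0; have := c_le; nra.
Qed.

(** The second-moment hypothesis [gap] with [eta = c / 2]. The bound on [rho] leaves
    [10 * c * ln 2 >= 5 * c], which absorbs [c / 2] and the multiples of [ln k / k], itself at most
    [c ^+ 2 / 10 ^+ 3]. *)
Lemma entropy_gap : rho * (1 + 28 / k%:R) + (1 + 20 * ln k%:R) / k%:R + c / 2 <= ln 2.
Proof.
have /andP[l1 l2] := ln2_bounds.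
have h1 := c_gt0; have h2 := c_le; have h3 := lnkk_le; have h4 := invk_le.
have h5 := rho_le; have h6 := density_le1; have h7 := density_ge0; have h8 := lnkk_gt0.
have k1 : 0 < k%:R^-1 :> R by rewrite invr_gt0 k_gt0_real.
have -> : (1 + 20 * ln k%:R) / k%:R = k%:R^-1 + 20 * (ln k%:R / k%:R) :> R by ring.
set L := ln k%:R / k%:R in h3 h4 h8 *; set I := k%:R^-1 in h4 k1 *.
have c2 : c ^+ 2 <= c / 10 by nra.
have r28 : rho * (1 + 28 * I) <= rho + 28 * I by nra.
have cl : 5 * c <= 10 * c * ln 2 by nra.
by lra.
Qed.

End NearPairs.

(* Flipping a fraction [x / k] of the variables with [c <= x <= 3 c] costs
   more energy than it gains entropy. *)
Lemma near_pair_exponent (R : realType) (n k m : nat) (c rho : R) (z : nat) :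
  (0 < n)%N -> 0 < c -> c <= 1 / 10 -> 1 - ln c <= c * ln k%:R ->
  10 ^+ 3 * ln k%:R <= c ^+ 2 * k%:R ->
  (1 + 10 * c) * (ln k%:R / k%:R) <= rho ->
  rho * n%:R - 1 <= m%:R * 2 ^- k ->
  c * n%:R / k%:R <= z%:R -> z%:R <= 3 * (c * n%:R / k%:R) ->
  c * n%:R / k%:R + z%:R * (ln k%:R - ln c) -
    m%:R * 2 ^- k * (1 + (1 - k%:R^-1) * (1 - (1 - z%:R / n%:R) ^+ k)) <=
  - (m%:R * 2 ^- k * (1 + 28 / k%:R)) - 2 * rate k c * n%:R + 1.
Proof.
move=> n_gt0 h1 h2 c_ln k_large rho_ge m_ge z1 z2; set v : R := 1 - z%:R / n%:R.
have N0 : 0 < n%:R :> R by rewrite ltr0n.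
have kM := k_ge_million h1 h2 c_ln k_large.
have K0 : 0 < k%:R :> R by clear -kM; lra.
have h4 := invk_le h1 h2 c_ln k_large.
have h8 := lnkk_gt0 h1 h2 c_ln k_large; have h3 := lnkk_le h1 h2 c_ln k_large.
have k1 : 0 < k%:R^-1 :> R by rewrite invr_gt0.
pose x : R := z%:R * k%:R / n%:R.
have zx : z%:R = x * n%:R / k%:R by rewrite /x; field; rewrite !gt_eqF.
have x1 : c <= x.
  move: z1; rewrite zx ler_pM2r ?invr_gt0 // ler_pM2r //.
have x2 : x <= 3 * c.
  have : x * n%:R / k%:R <= 3 * c * n%:R / k%:R.
    by rewrite -zx; apply: le_trans z2 _; rewrite !mulrA.
  by rewrite ler_pM2r ?invr_gt0 // ler_pM2r.
have v0 : 0 <= v.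
  rewrite /v zx subr_ge0 ler_pdivrMr // mul1r ler_pdivrMr // mulrC ler_pM2l //.
  by clear -kM h2 x2; lra.
(* [1 - exp(-x)] is at least [x / (1 + x)], and [x <= 3 * c]. *)
have vk : x * (1 - 3 * c) <= 1 - v ^+ k.
  have e1 : v <= expR (- (x / k%:R)).
    apply: le_trans (expR_ge1Dx _); rewrite /v zx le_eqVlt; apply/orP; left.
    by apply/eqP; field; rewrite !gt_eqF.
  have e2 : v ^+ k <= expR (- x).
    apply: le_trans (lerXn2r k _ _ e1) _; rewrite ?nnegrE ?expR_ge0 //.
    by rewrite -expRM_natl mulrN mulrC mulfVK ?gt_eqF.
  have e3 : expR (- x) <= (1 + x)^-1.
    by rewrite expRN lef_pV2 ?posrE ?expR_gt0 ?expR_ge1Dx //; lra.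
  have e4 : (1 + x)^-1 <= 1 - x * (1 - 3 * c).
    rewrite -[_^-1]div1r ler_pdivrMr; last by lra.
    by nra.
  by lra.
have vk1 : v ^+ k >= 0 by rewrite exprn_ge0.
set V := v ^+ k in vk vk1 *; set I := k%:R^-1 in k1 h4 *.
set L := ln k%:R / k%:R in h3 h4 h8 *.
pose W := (1 - I) * (1 - V) - 28 * I.
have Ic : I <= c * c / 10 ^+ 4 by clear -h3 h4; rewrite expr2 in h3; lra.
have [W1 W0 W2] := energy_factor_bounds h1 h2 x1 x2 k1 Ic vk1 vk; rewrite -/W in W1 W0 W2.
have mW : rho * n%:R * W - 1 <= m%:R * 2 ^- k * W.
  by apply: le_trans (ler_wpM2r W0 m_ge); rewrite mulrBl mul1r lerB.
have c310 : 0 <= 1 - 31 / 10 * c by clear -h2; lra.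
have x0 : 0 <= x by clear -x1 h1; lra.
have Lx0 : 0 <= L * x by rewrite mulr_ge0 // ltW.
(* The margin [10 * c] in the density survives the loss [31 / 10 * c], up to a second-order term at
   most [31 / 10 * c]. *)
have rW : (1 + 38 / 10 * c) * (L * x) <= rho * W.
  have r1 : (1 + 10 * c) * L * (x * (1 - 31 / 10 * c)) <= rho * W.
    by apply: ler_pM => //; clear -h1 h2 h8 x0 c310; apply: mulr_ge0 => //; lra.
  apply: le_trans r1.
  have -> : (1 + 10 * c) * L * (x * (1 - 31 / 10 * c)) =
     (1 + 10 * c) * (1 - 31 / 10 * c) * (L * x) by ring.
  by rewrite ler_wpM2r //; clear -h1 h2; nra.
(* The entropy exceeds [L * x * n] only by the factor [1 + c], thanks to the hypothesis on [ln c].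
   Of the energy margin [38 / 10 * c], more than [2 * c] remains, and [c * (L * x)] is at least
   [rate]. *)
have zl : c * n%:R * I + z%:R * (ln k%:R - ln c) <= (1 + c) * (L * x) * n%:R.
  apply: le_trans (_ : z%:R * (1 + ln k%:R - ln c) <= _).
    have -> : z%:R * (1 + ln k%:R - ln c) = z%:R + z%:R * (ln k%:R - ln c) by ring.
    by rewrite lerD2r.
  apply: le_trans (_ : z%:R * ((1 + c) * ln k%:R) <= _).
    by rewrite ler_wpM2l //; have := c_ln; clear; lra.
  by rewrite zx /L le_eqVlt; apply/orP; left; apply/eqP; field; rewrite gt_eqF.
have rn : (1 + 38 / 10 * c) * (L * x) * n%:R <= rho * W * n%:R by rewrite ler_wpM2r // ltW.
have rate_x : rate k c <= c * (L * x).
  by rewrite /rate -/L expr2 -mulrA ler_pM2l // [leLHS]mulrC ler_pM2l.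
have rx := ler_wpM2r (ltW N0) rate_x.
have -> : m%:R * 2 ^- k * (1 + (1 - I) * (1 - V)) =
   m%:R * 2 ^- k * (1 + 28 * I) + m%:R * 2 ^- k * W by rewrite /W; ring.
have p0 := mulr_ge0 (mulr_ge0 (ltW h1) Lx0) (ltW N0).
have e1 : (1 + c) * (L * x) * n%:R = L * x * n%:R + c * (L * x) * n%:R by ring.
have e2 : (1 + 38 / 10 * c) * (L * x) * n%:R =
   L * x * n%:R + 38 / 10 * (c * (L * x) * n%:R) by ring.
rewrite e1 in zl; rewrite e2 in rn.
rewrite mulrAC in mW.
by clear -mW zl rn p0 rx; lra.
Qed.

(** * Expected number of non-isolated solutions *)

Section BadSolutions.
Variables (R : realType) (n k m : nat).

Definition bad_solutions (A T : R) (w : lformula n k m) : {set assignment n} :=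
  [set s in lsolutions w |
    [exists t, (A <= (hamming s t)%:R <= 3 * A) && ((lenergy w t)%:R < T)]].

Lemma bad_solutionsE (A T : R) (w : lformula n k m) : formula_of w \in kcnf n k m ->
  [set s in solutions (formula_of w) | ~~ isolated (formula_of w) A T s] =
  bad_solutions A T w.
Proof.
move=> nice; apply/setP => s; rewrite [LHS]inE [RHS]inE solutions_formula_of; congr (_ && _).
rewrite negb_forall; apply: eq_existsb => t.
by rewrite negb_imply energy_formula_of // -ltNge.
Qed.

(** Exponential Markov inequality with a union bound over [t]: energy below [T] forces
    [q ^+ lenergy w t] to be at least [expR (T * ln q)]. *)
Lemma avg_bad_solutions_le (A T q : R) : (0 < n)%N -> (1 <= k)%N -> 0 < q -> q <= 1 ->
  avg (fun w : lformula n k m => #|bad_solutions A T w|%:R) <=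
  expR (T * - ln q) *
  \sum_(s : assignment n) \sum_(t | A <= (hamming s t)%:R <= 3 * A)
    expR (- (m%:R * 2 ^- k *
      (1 + (1 - q) * (1 - (1 - (hamming s t)%:R / n%:R) ^+ k)))).
Proof.
move=> n0 k1 q0 q1; have N0 : 0 < n%:R :> R by rewrite ltr0n.
have lq : 0 <= - ln q by rewrite oppr_ge0 ln_le0 // q1.
apply: le_trans (_ : avg (fun w : lformula n k m => \sum_(s : assignment n)
    \sum_(t | A <= (hamming s t)%:R <= 3 * A)
    expR (T * - ln q) * ((s \in lsolutions w)%:R * q ^+ lenergy w t)) <= _).
  apply: le_avg => w; rewrite -sum1_card natr_sum big_mkcond /=; apply: ler_sum => s _.
  have ge0 t : 0 <= expR (T * - ln q) * ((s \in lsolutions w)%:R * q ^+ lenergy w t).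
    by rewrite !mulr_ge0 ?expR_ge0 // exprn_ge0 // ltW.
  case: ifP => [|_]; last by apply: sumr_ge0.
  rewrite inE => /andP[-> /existsP[t /andP[rt et]]].
  rewrite (bigD1 t) //= mul1r -[leLHS]addr0; apply: lerD; last first.
    by apply: sumr_ge0 => i _; rewrite !mulr_ge0 ?expR_ge0 // exprn_ge0 // ltW.
  have -> : q ^+ lenergy w t = expR (- ((lenergy w t)%:R * - ln q)).
    by rewrite mulrN opprK expRM_natl lnK ?posrE.
  rewrite -expRD -mulrBl -[leLHS]expR0 ler_expR mulr_ge0 // subr_ge0 ltW //.
rewrite avg_sum mulr_sumr; apply: ler_sum => s _.
rewrite avg_sum mulr_sumr; apply: ler_sum => t _.
rewrite avgZ ler_pM2l ?expR_gt0 // avg_solution_energy //.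
have -> : (1 + overlap R s t) / 2 = 1 - (hamming s t)%:R / n%:R.
  by rewrite /overlap; field; rewrite gt_eqF.
set v := 1 - _ / _.
have v0 : 0 <= v by rewrite subr_ge0 ler_pdivrMr // mul1r ler_nat hamming_le.
have v1 : v <= 1 by rewrite lerBlDr lerDl divr_ge0.
have V0 := exprn_ge0 k v0; have V1 := exprn_ile1 k v0 v1.
have p2 : 0 < 2 ^- k :> R by rewrite invr_gt0 exprn_gt0.
have p2' : 2 ^- k <= 1 / 2 :> R.
  by rewrite div1r lef_pV2 ?posrE ?exprn_gt0 // -{1}[2]expr1 ler_weXn2l //; lra.
pose x := - (2 ^- k * (1 + (1 - q) * (1 - v ^+ k))).
have qv : 0 <= (1 - q) * (1 - v ^+ k) <= 1.
  apply/andP; split; first by rewrite mulr_ge0 // subr_ge0.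
  by rewrite mulr_ile1 ?subr_ge0 //; lra.
have -> : 1 - 2 ^- k - (1 - q) * (2 ^- k * (1 - v ^+ k)) = 1 + x by rewrite /x; ring.
apply: le_trans (expr_1Dx_le m _) _.
  by rewrite /x; move: qv; set y := (1 - q) * _ => /andP[y0 y1]; nra.
by rewrite /x mulrN mulrA.
Qed.

End BadSolutions.

(** The entropy of the shells is handled by the fugacity [c / k]: its generating function is at most
    [expR (c * n / k)], the extra term carried by [near_pair_exponent]. *)
Lemma sum_near_pairs_le (R : realType) (n k m : nat) (c rho : R) (s : assignment n) :
  (0 < n)%N -> 0 < c -> c <= 1 / 10 -> 1 - ln c <= c * ln k%:R ->
  10 ^+ 3 * ln k%:R <= c ^+ 2 * k%:R ->
  (1 + 10 * c) * (ln k%:R / k%:R) <= rho ->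
  rho * n%:R - 1 <= m%:R * 2 ^- k ->
  \sum_(t | c / k%:R * n%:R <= (hamming s t)%:R <= 3 * (c / k%:R * n%:R))
    expR (- (m%:R * 2 ^- k *
      (1 + (1 - k%:R^-1) * (1 - (1 - (hamming s t)%:R / n%:R) ^+ k)))) <=
  expR (- (m%:R * 2 ^- k * (1 + 28 / k%:R)) - 2 * rate k c * n%:R + 1).
Proof.
move=> n0 c0 c1 cl kl rge mge; set B := expR (_ + 1).
have kM := k_ge_million c0 c1 cl kl.
have K0 : 0 < k%:R :> R by clear -kM; lra.
pose y : R := c / k%:R; have y0 : 0 < y by rewrite divr_gt0.
apply: le_trans (_ : \sum_t y ^+ hamming s t * (expR (- (c * n%:R / k%:R)) * B) <= _).
  rewrite big_mkcond; apply: ler_sum => t _; case: ifP => [/andP[z1 z2]|_]; last first.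
    by rewrite !mulr_ge0 ?expR_ge0 // exprn_ge0 // ltW.
  have yE : y ^+ hamming s t = expR ((hamming s t)%:R * (ln c - ln k%:R)).
    by rewrite expRM_natl -ln_div ?posrE // lnK ?posrE.
  rewrite yE -!expRD ler_expR.
  have := near_pair_exponent n0 c0 c1 cl kl rge mge (z := hamming s t).
  rewrite mulrAC in z1 z2; move=> /(_ z1 z2).
  set a := c * n%:R / k%:R; set b := m%:R * _ * _; set d := _ + 1.
  by clear; lra.
rewrite -mulr_suml sum_expr_hamming mulrA ler_piMl ?expR_ge0 //.
rewrite expRN ler_pdivrMr ?expR_gt0 // mul1r.
apply: le_trans (expr_1Dx_le n (addr_ge0 ler01 (ltW y0))) _.
by rewrite ler_expR /y mulrA [n%:R * c]mulrC.
Qed.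

(** Chernoff bound: with [y = c / k < 1], the indicator of the ball of radius [y * n] is at most [y]
    to the power [hamming s t - y * n]. *)
Lemma card_ball_le (R : realType) (n k : nat) (c : R) (s : assignment n) :
  0 < c -> c <= 1 / 10 -> 1 - ln c <= c * ln k%:R ->
  10 ^+ 3 * ln k%:R <= c ^+ 2 * k%:R ->
  #|[set t | (hamming s t)%:R < c / k%:R * n%:R]|%:R <=
  expR ((1 + c) * c * (ln k%:R / k%:R) * n%:R).
Proof.
move=> c0 c1 cl kl.
have kM := k_ge_million c0 c1 cl kl.
have K0 : 0 < k%:R :> R by clear -kM; lra.
have lk := lnk_ge10 c0 c1 cl; have lc := lnc_lt0 c0 c1.
pose y : R := c / k%:R; have y0 : 0 < y by rewrite divr_gt0.
apply: le_trans (_ : \sum_t y ^+ hamming s t * expR (y * n%:R * (ln k%:R - ln c)) <= _).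
  rewrite -sum1_card natr_sum big_mkcond; apply: ler_sum => t _.
  have yE : y ^+ hamming s t = expR ((hamming s t)%:R * (ln c - ln k%:R)).
    by rewrite expRM_natl -ln_div ?posrE // lnK ?posrE.
  rewrite inE; case: ifP => [zA|_]; last by rewrite mulr_ge0 ?expR_ge0 // exprn_ge0 // ltW.
  rewrite yE -expRD -[leLHS]expR0 ler_expR -/y.
  have -> : (hamming s t)%:R * (ln c - ln k%:R) + y * n%:R * (ln k%:R - ln c) =
     (y * n%:R - (hamming s t)%:R) * (ln k%:R - ln c) by ring.
  by apply: mulr_ge0; [rewrite subr_ge0 ltW|clear -lk lc; lra].
rewrite -mulr_suml sum_expr_hamming.
apply: le_trans (ler_wpM2r (expR_ge0 _) (expr_1Dx_le n (addr_ge0 ler01 (ltW y0)))) _.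
rewrite -expRD ler_expR.
have -> : n%:R * y + y * n%:R * (ln k%:R - ln c) = y * n%:R * (1 - ln c + ln k%:R) by ring.
have -> : (1 + c) * c * (ln k%:R / k%:R) * n%:R = y * n%:R * ((1 + c) * ln k%:R).
  by rewrite /y; ring.
have yn0 : 0 <= y * n%:R by rewrite mulr_ge0 // ltW.
by rewrite ler_wpM2l //; clear -cl; lra.
Qed.

(** * Shattering with high probability *)

(** The deterministic part: a large partition function, a moderate sum of squared weights and few
    bad solutions suffice. *)
Lemma shattered_of_moments (R : realType) (n k m : nat) (c rho : R) (w : lformula n k m) :
  (0 < n)%N -> 0 < c -> c <= 1 / 10 -> 1 - ln c <= c * ln k%:R ->
  10 ^+ 3 * ln k%:R <= c ^+ 2 * k%:R ->
  (1 + 10 * c) * (ln k%:R / k%:R) <= rho ->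
  rho <= (1 - 10 * c) * ln 2 ->
  m%:R * 2 ^- k <= rho * n%:R ->
  1 <= c / k%:R * n%:R ->
  4 * n%:R * expR 1 <= expR (rate k c * n%:R / 2) ->
  formula_of w \in kcnf n k m ->
  2 ^+ n / 2 < partition_function R w ->
  \sum_s fweight R s w ^+ 2 < n%:R * (2 ^+ n * expR (m%:R * 2 ^- k * (1 + 28 / k%:R))) ->
  #|bad_solutions (c / k%:R * n%:R) (c ^+ 2 / k%:R * n%:R) w|%:R <
    expR (rate k c * n%:R / 4) *
    (2 ^+ n * expR (- (m%:R * 2 ^- k * (1 + 28 / k%:R)) - rate k c * n%:R + 1)) ->
  shattered (rate k c / 4) (rate k c / 4) (c / k%:R) (c ^+ 2 / k%:R) (formula_of w).
Proof.
move=> n0 c0 c1 cl kl rge rle mle An en nice hX hY hZ.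
have kM := k_ge_million c0 c1 cl kl.
have K0 : 0 < k%:R :> R by clear -kM; lra.
have N0 : 0 < n%:R :> R by rewrite ltr0n.
have r0 := rate_gt0 c0 c1 cl kl.
have L0 := lnkk_gt0 c0 c1 cl kl.
set mu := m%:R * 2 ^- k * (1 + 28 / k%:R) in hY hZ.
set rn := rate k c * n%:R in en hZ.
have P0 : 0 < 2 ^+ n :> R by rewrite exprn_gt0.
set S : R := #|lsolutions w|%:R.
have S0 : 0 <= S by rewrite ler0n.
(* Cauchy-Schwarz gives at least [2 ^+ n / (4 * n * expR mu)] solutions. *)
have hS : 2 ^+ n <= S * (4 * n%:R * expR mu).
  have k6 : (6 <= k)%N by rewrite -(ler_nat R); clear -kM; lra.
  have h1 := partition_function_le R n0 k6 w; rewrite -/S in h1.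
  have h2 : (2 ^+ n / 2) ^+ 2 <= partition_function R w ^+ 2.
    have q0 : 0 <= 2 ^+ n / 2 :> R by rewrite divr_ge0 // ltW.
    by rewrite lerXn2r ?nnegrE ?ltW // (le_lt_trans q0).
  have h3 := le_trans h2 (le_trans h1 (ler_wpM2l S0 (ltW hY))).
  rewrite -(ler_pM2l P0); move: h3; rewrite expr_div_n expr2.
  set P := 2 ^+ n; set E := expR mu => h3.
  have -> : P * (S * (4 * n%:R * E)) = 4 * (S * (n%:R * (P * E))) by ring.
  by clear -h3; lra.
have Spos : 0 < S.
  rewrite lt_neqAle S0 andbT; apply/eqP => z.
  by move: hS; rewrite -z mul0r; apply/negP; rewrite -ltNge.
have expneg : expR (- (rate k c / 4) * n%:R) = expR (- (rn / 4)).
  by congr expR; rewrite /rn; ring.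
have en' : 4 * n%:R <= expR (rn / 2).
  apply: le_trans en; rewrite ler_peMr ?mulr_ge0 // ?ltW //.
  by have := expR1_ge2 R; clear; lra.
apply: shattered_anchors => //.
- by rewrite !mulr_gt0 ?exprn_gt0 ?invr_gt0.
- by rewrite solutions_formula_of -card_gt0 -(ltr0n R).
- move=> s; rewrite solutions_formula_of -/S expneg.
  apply: le_trans (card_ball_le s c0 c1 cl kl) _.
  set ball := (1 + c) * c * _ * _.
  suff h : expR ball * expR (rn / 4) * (4 * n%:R * expR mu) <= 2 ^+ n.
    have F0 : 0 < 4 * n%:R * expR mu by rewrite !mulr_gt0 ?expR_gt0.
    have := le_trans h hS; rewrite ler_pM2r // => h'.
    by rewrite expRN mulrC ler_pdivlMr ?expR_gt0.
  apply: le_trans (_ : expR ball * expR (rn / 4) * (expR (rn / 2) * expR mu) <= _).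
    by rewrite ler_pM2l ?mulr_gt0 ?expR_gt0 // ler_pM2r ?expR_gt0.
  have -> : 2 ^+ n = expR (n%:R * ln 2) :> R by rewrite expRM_natl lnK ?posrE.
  rewrite -!expRD ler_expR.
  have gap := entropy_gap c0 c1 cl kl rge rle.
  have muE : mu <= rho * (1 + 28 / k%:R) * n%:R.
    have w0 : 0 <= 1 + 28 / k%:R :> R by rewrite addr_ge0 // divr_ge0 // ltW.
    by rewrite /mu [leRHS]mulrAC ler_wpM2r.
  have g := ler_wpM2l (ltW N0) gap.
  have -> : ball = (1 + c) * c * (ln k%:R / k%:R * n%:R) by rewrite /ball; ring.
  have -> : rn = c ^+ 2 * (ln k%:R / k%:R * n%:R) by rewrite /rn /rate; ring.
  have e1 : n%:R * (rho * (1 + 28 / k%:R) + (1 + 20 * ln k%:R) / k%:R + c / 2) =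
    rho * (1 + 28 / k%:R) * n%:R + n%:R / k%:R + 20 * (ln k%:R / k%:R * n%:R) + n%:R * (c / 2).
    by ring.
  rewrite e1 in g.
  have Ln0 : 0 <= ln k%:R / k%:R * n%:R :> R by rewrite mulr_ge0 // ltW.
  have nk0 : 0 <= n%:R / k%:R :> R by rewrite divr_ge0 // ltW.
  have nc0 : 0 <= n%:R * (c / 2) by rewrite mulr_ge0 // divr_ge0 // ltW.
  move: g muE Ln0 nk0 nc0.
  set Ln := ln k%:R / k%:R * n%:R; set a := n%:R / k%:R; set b := n%:R * (c / 2).
  set d := rho * _ * _ => g muE Ln0 nk0 nc0.
  have cc : (1 + c) * c * Ln <= 1 * Ln by rewrite ler_wpM2r //; clear -c0 c1; nra.
  have cc2 : c ^+ 2 * Ln <= 1 * Ln by rewrite ler_wpM2r //; clear -c0 c1; nra.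
  by clear -g muE Ln0 nk0 nc0 cc cc2; lra.
- rewrite bad_solutionsE // solutions_formula_of -/S expneg.
  (* Of the decay [rn], a quarter was spent on Markov's inequality and a half pays for
     [4 * n * expR 1]; the last quarter is the final rate. *)
  apply: le_trans (ltW hZ) _.
  have -> : expR (rn / 4) * (2 ^+ n * expR (- mu - rn + 1)) =
    2 ^+ n * (expR (- mu) * (expR (rn / 4 - rn) * expR 1)).
    rewrite mulrCA -!expRD; congr (_ * expR _).
    by clear; lra.
  apply: le_trans (ler_wpM2r _ hS) _; first by rewrite !mulr_ge0 ?expR_ge0.
  have -> : S * (4 * n%:R * expR mu) * (expR (- mu) * (expR (rn / 4 - rn) * expR 1)) =
    S * (4 * n%:R * expR 1) * expR (rn / 4 - rn) * (expR mu * expR (- mu)) by ring.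
  rewrite -expRD addrN expR0 mulr1 -mulrA mulrC ler_wpM2r //.
  apply: le_trans (ler_wpM2r (expR_ge0 _) en) _.
  by rewrite -expRD ler_expR; clear; lra.
Qed.

(** Union bound over the three failures: the first by the second moment, the others by Markov at
    thresholds [n] and [expR (rn / 4)] times the mean bounds. *)
Lemma prob_not_shattered_le (R : realType) (n k m : nat) (c rho delta : R) :
  (0 < n)%N -> 0 < c -> c <= 1 / 10 -> 1 - ln c <= c * ln k%:R ->
  10 ^+ 3 * ln k%:R <= c ^+ 2 * k%:R ->
  (1 + 10 * c) * (ln k%:R / k%:R) <= rho ->
  rho <= (1 - 10 * c) * ln 2 ->
  rho * n%:R - 1 <= m%:R * 2 ^- k ->
  m%:R * 2 ^- k <= rho * n%:R ->
  1 <= c / k%:R * n%:R ->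
  4 * n%:R * expR 1 <= expR (rate k c * n%:R / 2) ->
  0 < delta ->
  prob R (fun w : lformula n k m => (formula_of w \in kcnf n k m) &&
    ~~ `[< shattered (rate k c / 4) (rate k c / 4) (c / k%:R) (c ^+ 2 / k%:R) (formula_of w) >]) <=
  4 * (expR (2 * delta) - 1) +
  (8 * (6 ^+ 6 / ((c / 2) ^+ 6 * delta ^+ 4)) + 1 + 4 / rate k c) / n%:R.
Proof.
move=> n0 c0 c1 cl kl rge rle mge mle An en d0.
have kM := k_ge_million c0 c1 cl kl.
have K0 : 0 < k%:R :> R by clear -kM; lra.
have N0 : 0 < n%:R :> R by rewrite ltr0n.
have r0 := rate_gt0 c0 c1 cl kl.
have P0 : 0 < 2 ^+ n :> R by rewrite exprn_gt0.
have k6 : (6 <= k)%N by rewrite -(ler_nat R); clear -kM; lra.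
pose mu : R := m%:R * 2 ^- k * (1 + 28 / k%:R).
pose rn := rate k c * n%:R.
pose A := c / k%:R * n%:R; pose T := c ^+ 2 / k%:R * n%:R.
pose bX (w : lformula n k m) := partition_function R w <= 2 ^+ n / 2.
pose bY (w : lformula n k m) := n%:R * (2 ^+ n * expR mu) <= \sum_s fweight R s w ^+ 2.
pose bZ (w : lformula n k m) := expR (rn / 4) * (2 ^+ n * expR (- mu - rn + 1)) <=
   #|bad_solutions A T w|%:R.
apply: le_trans (_ : prob R bX + (prob R bY + prob R bZ) <= _).
  apply: le_trans (_ : prob R (fun w => bX w || (bY w || bZ w)) <= _); last first.
    by apply: le_trans (@probU R _ bX (fun w => bY w || bZ w)) _; rewrite lerD2l probU.
  apply: le_prob => w /andP[nice]; apply: contraR; rewrite !negb_or -!ltNge.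
  move=> /and3P[h1 h2 h3]; apply/asboolP.
  exact: (shattered_of_moments n0 c0 c1 cl kl rge rle mle An en nice h1 h2 h3).
have hX : prob R bX <= 4 * (expR (2 * delta) - 1) +
    8 * (6 ^+ 6 / ((c / 2) ^+ 6 * delta ^+ 4)) / n%:R.
  have eta0 : 0 < c / 2 by rewrite divr_gt0.
  have eta1 : c / 2 <= 1 / 16 by clear -c1; lra.
  have := prob_partition_function_small n0 kM (density_ge0 c0 c1 cl kl rge) (density_le1 c0 c1 rle)
    eta0 eta1 mle (entropy_gap c0 c1 cl kl rge rle) d0.
  move=> h; apply: le_trans h _; rewrite mulrDr lerD2l.
  set e6 := (c / 2) ^+ 6; set d4 := delta ^+ 4; set C := 6 ^+ 6 : R.
  have e60 : 0 < e6 by rewrite exprn_gt0.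
  have d40 : 0 < d4 by rewrite exprn_gt0.
  have C0 : 0 < C by rewrite exprn_gt0.
  have -> : 8 * (C / (e6 * d4)) / n%:R = 4 * (2 * n%:R * (C / (e6 * (n%:R ^+ 2 * d4)))).
    by field; rewrite !gt_eqF.
  have D0 := divr_ge0 (ltW C0) (ltW (mulr_gt0 e60 (mulr_gt0 (exprn_gt0 2 N0) d40))).
  rewrite ler_pM2l // ler_wpM2r //.
  by rewrite -natr1 -[2]/(1 + 1) mulrDl mul1r lerD2l ler1n.
have hY : prob R bY <= 1 / n%:R.
  apply: le_trans (markov_avg _ _) _.
  - by rewrite !mulr_gt0 ?expR_gt0.
  - by move=> w; apply: sumr_ge0 => s _; rewrite sqr_ge0.
  rewrite avg_sum_fweight_sqr // ler_pdivrMr ?mulr_gt0 ?expR_gt0 //.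
  rewrite [leRHS]mulrA div1r mulVf ?gt_eqF //.
  rewrite mul1r ler_pM2l //.
  have u1 : `|1| <= 1 :> R by rewrite normr1.
  have cor := correlation_le1 kM u1.
  have cor2 := correlation_cubic kM u1.
  rewrite normr1 expr1n mulr1 in cor2.
  have p2 : 0 < 2 ^- k :> R by rewrite invr_gt0 exprn_gt0.
  have p2' : 2 ^- k <= 1 / 2 :> R.
    rewrite div1r lef_pV2 ?posrE ?exprn_gt0 // -{1}[2]expr1 ler_weXn2l //; first by clear; lra.
    by clear -k6; lia.
  have := ler_norm (correlation k (1 : R)); have := ler_norm (- correlation k (1 : R)).
  rewrite normrN => l1 l2.
  apply: le_trans (expr_1Dx_le m _) _.
    move: p2 p2' cor2 l1 l2; set x := 2 ^- k; set y := correlation k 1; clear => *.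
    by nra.
  have mm : 0 <= m%:R * 2 ^- k :> R by rewrite mulr_ge0 // ltW.
  by rewrite ler_expR /mu mulrA ler_wpM2l // (le_trans l2 cor).
have hZ : prob R bZ <= 4 / rate k c / n%:R.
  apply: le_trans (markov_avg _ _) _ => //; first by rewrite !mulr_gt0 ?expR_gt0.
  have kV0 : 0 < k%:R^-1 :> R by rewrite invr_gt0.
  have kV1 : k%:R^-1 <= 1 :> R by rewrite invf_le1 //; clear -kM; lra.
  have k1 : (1 <= k)%N by clear -k6; lia.
  have b1 : avg (fun w : lformula n k m => #|bad_solutions A T w|%:R) <=
      2 ^+ n * expR (- mu - rn + 1).
    apply: le_trans (avg_bad_solutions_le m A T n0 k1 kV0 kV1) _.
    apply: le_trans (ler_wpM2l (expR_ge0 _) (ler_sum _ (fun s _ =>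
      sum_near_pairs_le s n0 c0 c1 cl kl rge mge))) _.
    rewrite sumr_const card_assignment -[X in _ * X]mulr_natl natrX mulrCA ler_pM2l //.
    rewrite -expRD ler_expR lnV ?posrE // opprK.
    (* The threshold [c ^+ 2 / k * n] is tuned so that, with [q = 1 / k], the Chernoff factor costs
       [rn], half of the [2 * rn] gained on near pairs. *)
    have -> : T * ln k%:R = rn by rewrite /T /rn /rate; ring.
    rewrite -/mu -[2 * _ * _]mulrA -/rn.
    by clear; lra.
  have B0 : 0 < 2 ^+ n * expR (- mu - rn + 1) by rewrite mulr_gt0 ?expR_gt0.
  have B1 : 0 < expR (rn / 4) * (2 ^+ n * expR (- mu - rn + 1)) by rewrite mulr_gt0 ?expR_gt0.
  apply: le_trans (ler_wpM2r (ltW (_ : 0 < _^-1)) b1) _; first by rewrite invr_gt0.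
  rewrite invfM mulrCA mulfV ?gt_eqF // mulr1.
  have -> : 4 / rate k c / n%:R = (rn / 4)^-1 by rewrite /rn; field; rewrite !gt_eqF.
  have rn0 : 0 < rn / 4 by rewrite divr_gt0 // mulr_gt0.
  rewrite lef_pV2 ?posrE ?expR_gt0 //.
  by apply: le_trans (expR_ge1Dx _); rewrite lerDr.
apply: le_trans (lerD hX (lerD hY hZ)) _.
by rewrite le_eqVlt; apply/orP; left; apply/eqP; clear; ring.
Qed.

Lemma shatters_of_bounds (R : realType) (k : nat) (c r : R) :
  0 < c -> c <= 1 / 10 -> 1 - ln c <= c * ln k%:R ->
  10 ^+ 3 * ln k%:R <= c ^+ 2 * k%:R ->
  (1 + 10 * c) * (2 ^+ k / k%:R) * ln k%:R <= r ->
  r <= (1 - 10 * c) * 2 ^+ k * ln 2 ->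
  shatters k r.
Proof.
move=> c0 c1 cl kl rge rle.
have kM := k_ge_million c0 c1 cl kl.
have K0 : 0 < k%:R :> R by clear -kM; lra.
have r0 := rate_gt0 c0 c1 cl kl.
have p0 : 0 < 2 ^+ k :> R by rewrite exprn_gt0.
pose rho := r * 2 ^- k.
have rge' : (1 + 10 * c) * (ln k%:R / k%:R) <= rho.
  rewrite /rho ler_pdivlMr //; apply: le_trans rge.
  by rewrite le_eqVlt; apply/orP; left; apply/eqP; ring.
have rle' : rho <= (1 - 10 * c) * ln 2 by rewrite /rho ler_pdivrMr // mulrAC.
have rho0 := density_ge0 c0 c1 cl kl rge'.
have R0 : 0 <= r by rewrite -[r](mulfVK (lt0r_neq0 p0)) mulr_ge0 // ltW.
exists (rate k c / 4), (rate k c / 4), (c / k%:R), (c ^+ 2 / k%:R); split.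
  by split; rewrite divr_gt0 ?exprn_gt0.
apply: whp_kcnf_of_iid => //; first by rewrite -(ler_nat R); clear -kM; lra.
move=> e e0.
(* Solves [4 * (expR (2 * delta) - 1) = e / 4]. *)
pose delta := ln (1 + e / 16) / 2.
have e1 : 1 < 1 + e / 16 by clear -e0; lra.
have d0 : 0 < delta by rewrite divr_gt0 // ln_gt0.
pose C := 8 * (6 ^+ 6 / ((c / 2) ^+ 6 * delta ^+ 4)) + 1 + 4 / rate k c.
have C0 : 0 <= C.
  rewrite /C !addr_ge0 // ?divr_ge0 ?(ltW r0) // mulr_ge0 // divr_ge0 ?exprn_ge0 //.
  have ce : 0 <= c / 2 by rewrite divr_ge0 // ltW.
  by rewrite mulr_ge0 ?exprn_ge0 // ltW.
(* The summands ensure in turn that [C / n <= e / 2], that the radius is at least 1, and that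
   [4 * n * expR 1] is at most [expR (rate k c * n / 2)]. *)
pose B := C * 2 / e + k%:R / c + 64 * expR 1 / rate k c ^+ 2.
have B1 : 0 <= C * 2 / e by rewrite divr_ge0 ?mulr_ge0 // ltW.
have B2 : 0 <= k%:R / c by rewrite divr_ge0 ?ltW.
have B3 : 0 <= 64 * expR 1 / rate k c ^+ 2.
  exact: divr_ge0 (mulr_ge0 (ler0n _ _) (expR_ge0 _)) (sqr_ge0 _).
have B0 : 0 <= B by rewrite !addr_ge0.
exists (Num.truncn B).+1 => n Bn.
have n0 : (0 < n)%N by apply: leq_trans Bn.
have N0 : 0 < n%:R :> R by rewrite ltr0n.
have {}Bn : B <= n%:R.
  by have /andP[_ /ltW h] := truncn_itv B0; apply: le_trans h _; rewrite ler_nat.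
have n1 : C * 2 / e <= n%:R by rewrite /B in Bn; clear -Bn B1 B2 B3; lra.
have n2 : k%:R / c <= n%:R by rewrite /B in Bn; clear -Bn B1 B2 B3; lra.
have n3 : 64 * expR 1 / rate k c ^+ 2 <= n%:R by rewrite /B in Bn; clear -Bn B1 B2 B3; lra.
set m := Num.truncn (r * n%:R).
have rn0 : 0 <= r * n%:R by rewrite mulr_ge0.
have /andP[m1 m2] := truncn_itv rn0; rewrite -/m in m1 m2.
have mle : m%:R * 2 ^- k <= rho * n%:R.
  by rewrite /rho mulrAC ler_pM2r ?invr_gt0.
have mge : rho * n%:R - 1 <= m%:R * 2 ^- k.
  rewrite lerBlDr; apply: le_trans (_ : (m%:R + 1) * 2 ^- k <= _).
    by rewrite /rho mulrAC ler_pM2r ?invr_gt0 // natr1 ltW.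
  rewrite mulrDl mul1r lerD2l invf_le1 // exprn_ege1 //; clear; lra.
have An : 1 <= c / k%:R * n%:R.
  by rewrite mulrAC ler_pdivlMr // mul1r mulrC -ler_pdivrMr.
have en : 4 * n%:R * expR 1 <= expR (rate k c * n%:R / 2).
  have -> : rate k c * n%:R / 2 = 2 * (rate k c * n%:R / 4) by field.
  rewrite expRM_natl; apply: le_trans (_ : (rate k c * n%:R / 4) ^+ 2 <= _); last first.
    have x0 : 0 <= rate k c * n%:R / 4.
      exact: divr_ge0 (mulr_ge0 (ltW r0) (ltW N0)) (ler0n _ _).
    apply: lerXn2r; rewrite ?nnegrE ?expR_ge0 //.
    by apply: le_trans (expR_ge1Dx _); rewrite lerDr.
  rewrite ler_pdivrMr ?exprn_gt0 // in n3.
  have := ler_wpM2r (ltW N0) n3; set q := rate k c.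
  have -> : (q * n%:R / 4) ^+ 2 = n%:R * q ^+ 2 * n%:R / 16 by field.
  by clear; lra.
apply: le_trans (prob_not_shattered_le n0 c0 c1 cl kl rge' rle' mge mle An en d0) _.
have -> : 2 * delta = ln (1 + e / 16) by rewrite /delta; field.
rewrite lnK ?posrE ?(lt_trans ltr01 e1) // -/C.
have : C / n%:R <= e / 2.
  rewrite ler_pdivrMr //; move: n1; rewrite ler_pdivrMr //; clear; lra.
by clear -e0; lra.
Qed.

(** * Choice of the sequence epsilon *)

Section Slack.
Variable R : realType.

Definition slack (k : nat) : R := (Num.sqrt (ln k%:R))^-1.

Definition slack_ok (k : nat) : bool :=
  [&& 0 < slack k, slack k <= 1 / 10, 1 - ln (slack k) <= slack k * ln k%:R
    & 10 ^+ 3 * ln k%:R <= slack k ^+ 2 * k%:R].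

Lemma slack_ok_large (k : nat) : (0 < k)%N -> 30 ^+ 3 <= ln k%:R :> R -> slack_ok k.
Proof.
move=> k0 Lk; have K0 : 0 < k%:R :> R by rewrite ltr0n.
have kE : k%:R = expR (ln k%:R) :> R by rewrite lnK ?posrE.
rewrite /slack_ok /slack; set L := ln k%:R in Lk kE *; set s := Num.sqrt L.
have L0 : 0 < L by clear -Lk; lra.
have s2 : s ^+ 2 = L by rewrite sqr_sqrtr // ltW.
have s0 : 0 < s by rewrite sqrtr_gt0.
have s10 : 10 <= s.
  by rewrite leNgt; apply/negP => s10; clear -s2 s0 s10 Lk; nra.
apply/and4P; split.
- by rewrite invr_gt0.
- by rewrite div1r lef_pV2 ?posrE.
(* With [c = 1 / s] and [ln k = s ^+ 2] the condition reads [1 + ln s <= s]. *)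
- rewrite lnV ?posrE // opprK -s2 expr2 mulKf ?gt_eqF //.
  have : ln (1 + (s - 1)) <= s - 1 by apply: le_ln1Dx; clear -s0; lra.
  by rewrite addrCA subrr addr0; clear; lra.
rewrite exprVn s2 [leRHS]mulrC ler_pdivlMr // kE.
have -> : L = 3 * (L / 3) by field.
rewrite expRM_natl.
have e3 : (L / 3) ^+ 3 <= expR (L / 3) ^+ 3.
  apply: lerXn2r; rewrite ?nnegrE ?expR_ge0 ?divr_ge0 ?(ltW L0) //.
  by apply: le_trans (expR_ge1Dx _); rewrite lerDr.
apply: le_trans e3.
have -> : 10 ^+ 3 * (3 * (L / 3)) * (3 * (L / 3)) = 10 ^+ 3 * (L * L) by field.
have -> : (L / 3) ^+ 3 = L / 27 * (L * L) by field.
rewrite ler_wpM2r ?mulr_ge0 ?(ltW L0) //.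
by clear -Lk; lra.
Qed.

(** The value 2, taken for finitely many [k] only, makes the upper bound on [r] negative, so the
    range of densities is empty. *)
Definition shatter_eps (k : nat) : R := if slack_ok k then 10 * slack k else 2.

Lemma shatter_eps_cvg0 : (shatter_eps @ \oo --> (0 : R))%classic.
Proof.
apply/cvgrPdist_le => e e0.
(* The first summand ensures [slack_ok], the second [10 / sqrt (ln k) <= e]. *)
pose B : R := 30 ^+ 3 + (10 / e) ^+ 2.
have B1 : 30 ^+ 3 <= B by rewrite lerDl sqr_ge0.
exists (Num.truncn (expR B)).+1 => // k /= Bk.
have k0 : (0 < k)%N by apply: leq_trans Bk.
have LB : B <= ln k%:R.
  rewrite -ler_expR lnK ?posrE ?ltr0n //.
  have /andP[_ /ltW h] := truncn_itv (expR_ge0 B).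
  by apply: le_trans h _; rewrite ler_nat.
have ok := slack_ok_large k0 (le_trans B1 LB).
rewrite /shatter_eps ok sub0r normrN.
have /and4P[s0 _ _ _] := ok.
rewrite ger0_norm ?mulr_ge0 ?(ltW s0) // /slack.
rewrite invr_gt0 in s0; rewrite ler_pdivrMr // mulrC -ler_pdivrMr //.
rewrite -[leLHS]gtr0_norm ?divr_gt0 // -sqrtr_sqr ler_sqrt.
  by apply: le_trans LB; rewrite lerDr exprn_ge0.
by apply: le_trans LB; apply: le_trans B1; clear; lra.
Qed.

End Slack.

Theorem theorem2 (R : realType) :
  exists eps : nat -> R,
    (eps @ \oo --> (0 : R))%classic /\
    forall (k : nat) (r : R), (0 < k)%N ->
      (1 + eps k) * (2 ^+ k / k%:R) * ln k%:R <= r ->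
      r <= (1 - eps k) * 2 ^+ k * ln 2 ->
      shatters k r.
Proof.
exists (@shatter_eps R); split; first exact: shatter_eps_cvg0.
move=> k r k0; rewrite /shatter_eps; case: ifP => [/and4P[c0 c1 cl kl]|_] rge rle.
  exact: shatters_of_bounds rge rle.
have p0 : 0 < 2 ^+ k :> R by rewrite exprn_gt0.
have l2 : 0 < ln 2 :> R by rewrite ln_gt0 // ltr1n.
(* For [eps k = 2] the hypotheses would give [0 <= r <= - (2 ^+ k * ln 2) < 0]. *)
have h1 : 0 <= (1 + 2) * (2 ^+ k / k%:R) * ln k%:R :> R.
  by rewrite !mulr_ge0 ?addr_ge0 ?invr_ge0 ?(ltW p0) // ln_ge0 // ler1n.
have h2 : 0 < 2 ^+ k * ln 2 :> R by rewrite mulr_gt0.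
have := le_trans h1 (le_trans rge rle); rewrite -mulrA.
by move: h2; set x := 2 ^+ k * ln 2; clear => *; exfalso; lra.
Qed.
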